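(* There exist absolute constants $c,C>0$ such that the following holds. Consider the low-rank linear bandit problem with horizon $T$ and unknown parameter $\Theta^*\in\mathbb{R}^{d_1\times d_2}$ of rank $r$. For every $\delta\in(0,0.25]$, the algorithm LowLOC, run with exponential-weights constant $\eta=c/\log(T/\delta)$ and with $B_t=C(d_1+d_2)\,r\,\log(9T)\log(2T/\delta)$ for all $t$, satisfies with probability at least $1-\delta$ $$R_T=\widetilde{O}\left((d_1+d_2)^{3/2}\sqrt{rT}\sqrt{\log\left(\tfrac1\delta\right)}\right).$$
   Context: Notation: $\langle A,B\rangle=\mathrm{trace}(A^TB)$, $\|\cdot\|_F$ is the Frobenius norm. $X=\widetilde{O}(Y)$ means $X\le C'\log^p(2+d_1+d_2+r+T)\,Y$ for some absolute constants $C',p>0$. Low-rank linear bandit. $\mathcal{X}\subset\mathbb{R}^{d_1\times d_2}$ is an arm set with $\|X\|_F\le1$ for all $X\in\mathcal{X}$; $\Theta^*\in\mathbb{R}^{d_1\times d_2}$ is unknown with rank $r$ and $\|\Theta^*\|_F\le1$. In round $t=1,\dots,T$ the learner picks $X_t\in\mathcal{X}$ (based on the past) and observes $y_t=\langle X_t,\Theta^*\rangle+\eta_t$, where $\eta_t$ is zero-mean $1$-sub-Gaussian noise, conditionally on $X_t$ and $\{(X_s,\eta_s)\}_{s<t}$. The (pseudo-)regret is $R_T=\sum_{t=1}^T\langle X^*-X_t,\Theta^*\rangle$ with $X^*\in\arg\max_{X\in\mathcal{X}}\langle X,\Theta^*\rangle$. Let $S_r=\{\Theta\in\mathbb{R}^{d_1\times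 d_2}:\|\Theta\|_F\le1,\ \mathrm{rank}(\Theta)\le r\}$ and let $\bar S_r(1/T)=\{\Theta_1,\dots,\Theta_N\}\subset S_r$ be a $\frac1T$-net of $S_r$ in Frobenius norm (every $\Theta\in S_r$ is within $\frac1T$ of some $\Theta_i$) with $N\le(9T)^{(d_1+d_2+1)r}$. Algorithm LowLOC (parameters $\delta,\eta$, sequence $B_t$). Set $\mathcal{C}_0=\{\Theta\in\mathbb{R}^{d_1\times d_2}:\|\Theta\|_F^2\le1\}$ and $L_{i,0}=0$. For $t=1,\dots,T$: (1) choose $(X_t,\widetilde\Theta_t)\in\arg\max_{(X,\Theta)\in\mathcal{X}\times\mathcal{C}_{t-1}}\langle X,\Theta\rangle$ (maxima are assumed attained), pull $X_t$ and observe $y_t$; (2) compute the exponentially weighted prediction $\hat y_t=\frac{\sum_{i=1}^Ne^{-\eta L_{i,t-1}}\langle X_t,\Theta_i\rangle}{\sum_{j=1}^Ne^{-\eta L_{j,t-1}}}$; (3) update $L_{i,t}=\sum_{s=1}^t(y_s-\langle X_s,\Theta_i\rangle)^2$; (4) set $\mathcal{C}_t=\{\Theta\in\mathbb{R}^{d_1\times d_2}:\|\Theta\|_F^2+\sum_{s=1}^t(\hat y_s-\langle\Theta,X_s\rangle)^2\le1+\beta_t(\delta)\}$, where $\beta_t(\delta)=1+2B_t+32\log\left(\frac{\sqrt8+\sqrt{1+B_t}}{\delta}\right)$. *)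

(* Defs.v *)
From HB Require Import structures.
From mathcomp Require Import all_boot all_order all_algebra.
From mathcomp Require Import all_classical all_reals all_analysis.

Set Implicit Arguments.
Unset Strict Implicit.
Unset Printing Implicit Defensive.

Import Order.TTheory GRing.Theory Num.Theory.
Import numFieldNormedType.Exports.

Local Open Scope classical_set_scope.
Local Open Scope ring_scope.

Section Matrices.
Context {R : realType} {d1 d2 : nat}.
Implicit Types A B : 'M[R]_(d1, d2).

Definition mxinner A B : R := \tr (A^T *m B).

Definition frobenius A : R := Num.sqrt (mxinner A A).

Definition low_rank_ball (r : nat) : set 'M[R]_(d1, d2) :=
  [set A | frobenius A <= 1 /\ (\rank A <= r)%N].

(* The points of the net are an indexed family; repetitions are allowed. *)
Definition is_net (N : nat) (net : 'I_N -> 'M[R]_(d1, d2))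
    (S : set 'M[R]_(d1, d2)) (eps : R) : Prop :=
  (forall i, S (net i)) /\
  (forall A, S A -> exists i, frobenius (A - net i) <= eps).

End Matrices.

Definition is_argmax {R : realType} {U : Type} (S : set U) (f : U -> R) (x : U)
    : Prop :=
  S x /\ (forall y, S y -> f y <= f x).

Section Probability.
Context {d : measure_display} {Omega : measurableType d} {R : realType}.
Variable P : probability Omega R.

(* [g] is a version of the conditional expectation of [f] given the
   sigma-algebra [G]. *)
Definition is_cond_expectation (G : set (set Omega)) (f g : Omega -> R) : Prop :=
  [/\ P.-integrable setT (EFin \o f),
      P.-integrable setT (EFin \o g),
      (forall U : set R, measurable U -> G (g @^-1` U)) &
      (forall A, G A ->
        (\int[P]_(w in A) (g w)%:E = \int[P]_(w in A) (f w)%:E)%E)].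

(* E[f | G] = 0 and, for every lambda,
   E[exp (lambda f) | G] <= exp (lambda ^ 2 / 2) almost surely. *)
Definition cond_centered_subgaussian (G : set (set Omega)) (f : Omega -> R)
    : Prop :=
  is_cond_expectation G f (cst 0) /\
  (forall lambda : R, exists g : Omega -> R,
    is_cond_expectation G (fun w => expR (lambda * f w)) g /\
    {ae P, forall w, g w <= expR (lambda ^+ 2 / 2)}).

End Probability.

Section Bandit.
Context {R : realType} {d1 d2 : nat}.

(* Rounds are numbered from 1; values of the processes at index 0 are unused. *)

(* The sigma-algebra generated by X_1, ..., X_t and eta_1, ..., eta_(t-1),
   matrices being identified with the family of their entries. *)
Definition history {d : measure_display} {Omega : measurableType d}
    (X : nat -> Omega -> 'M[R]_(d1, d2)) (noise : nat -> Omega -> R) (t : nat)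
    : set (set Omega) :=
  <<s [set A | (exists s i j, (1 <= s <= t)%N /\
                 g_sigma_algebra_preimage (fun w => X s w i j) A) \/
               (exists s, (1 <= s < t)%N /\
                 g_sigma_algebra_preimage (noise s) A)] >>.

Definition regret (Theta Xstar : 'M[R]_(d1, d2)) (X : nat -> 'M[R]_(d1, d2))
    (T : nat) : R :=
  \sum_(1 <= t < T.+1) mxinner (Xstar - X t) Theta.

Section LowLOC.
Variables (N : nat) (net : 'I_N -> 'M[R]_(d1, d2)).
Variables (delta eta : R) (B : nat -> R).
(* One realization of the pulled arms and of the observed rewards. *)
Variables (X : nat -> 'M[R]_(d1, d2)) (y : nat -> R).

Definition cum_loss (i : 'I_N) (t : nat) : R :=
  \sum_(1 <= s < t.+1) (y s - mxinner (X s) (net i)) ^+ 2.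

Definition ew_prediction (t : nat) : R :=
  (\sum_(i < N) expR (- eta * cum_loss i t.-1) * mxinner (X t) (net i)) /
  (\sum_(j < N) expR (- eta * cum_loss j t.-1)).

Definition conf_radius (t : nat) : R :=
  1 + 2 * B t
  + 32 * ln ((Num.sqrt 8 + Num.sqrt (1 + B t)) / delta).

Definition conf_set (t : nat) : set 'M[R]_(d1, d2) :=
  if t is 0%N then [set Theta | frobenius Theta ^+ 2 <= 1]
  else [set Theta |
    frobenius Theta ^+ 2
    + \sum_(1 <= s < t.+1) (ew_prediction s - mxinner Theta (X s)) ^+ 2
    <= 1 + conf_radius t].

(* The confidence sets need not contain the unknown parameter and may even be
   empty on an event of small positive probability (for instance with Gaussian
   noise); the optimistic choice is then undefined, and the learner may pull
   any arm.  Ties in the maximization are broken arbitrarily. *)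
Definition lowloc_run (arms : set 'M[R]_(d1, d2)) (T : nat)
    (Thetat : nat -> 'M[R]_(d1, d2)) : Prop :=
  forall t, (1 <= t <= T)%N ->
    arms (X t) /\
    (conf_set t.-1 !=set0 ->
      is_argmax (arms `*` conf_set t.-1) (fun p => mxinner p.1 p.2)
        (X t, Thetat t)).

End LowLOC.
End Bandit.

(* Main.v *)
(** No truncation of the noise is needed.  Let [g_s] be the
    prediction error [yhat_s - <X_s, Theta>] and let [i0] be a net point near
    [Theta].  With [kappa = 1/16] and the exponential weights [p_(i,s)] (of any
    rate [eta = kappa / rho], [rho >= 1]), the product over [s <= t] of

      [exp (kappa g_s^2 / 2 - 2 / T^2)
         * sum_i p_(i,s) exp (- kappa (l_(i,s) - l_(i0,s)))],

    [l_(i,s)] being the squared loss of the net point [i], is a nonnegative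
    supermartingale: integrating the noise out turns [l_(i,s) - l_(i0,s)] into a
    multiple of the squared deviation of [i] from [Theta], and
    [x |-> exp (- kappa x^2 / 2)] is concave on the relevant range.  Jensen's
    inequality for the power [rho] and the telescoping of the exponential
    weights bound this product below by
    [exp (kappa / 2 * sum g_s^2 - 2 / T - rho ln N)], so Markov's inequality
    controls [sum_(s <= T) g_s^2], which is monotone in the horizon: all the
    confidence sets contain [Theta] at once.  The regret then follows from
    optimism and the elliptical potential lemma in dimension [d1 d2]. *)
Require Import Defs.
From HB Require Import structures.
From mathcomp Require Import all_boot all_order all_algebra.
From mathcomp Require Import all_classical all_reals all_analysis.
From mathcomp Require Import measurable_realfun ring lra.
Import Order.TTheory GRing.Theory Num.Theory.
Import numFieldNormedType.Exports.
Local Open Scope classical_set_scope.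
Local Open Scope ring_scope.

(** * Positive definite matrices and their determinants *)

Section PositiveDefinite.
Context {R : realType}.

Definition bform {n} (V : 'M[R]_n) (u v : 'rV[R]_n) : R := (u *m V *m v^T) 0 0.

Definition posdef {n} (V : 'M[R]_n) : Prop :=
  V^T = V /\ forall u, u != 0 -> 0 < bform V u u.

Lemma bformC {n} (V : 'M[R]_n) u v : V^T = V -> bform V u v = bform V v u.
Proof.
move=> Vsym; rewrite /bform.
have -> : u *m V *m v^T = (v *m V *m u^T)^T.
  by rewrite !trmx_mul trmxK Vsym mulmxA.
by rewrite mxE.
Qed.

Lemma bformDl {n} (V : 'M[R]_n) u v w :
  bform V (u + v) w = bform V u w + bform V v w.
Proof. by rewrite /bform !mulmxDl mxE. Qed.

Lemma bformDr {n} (V : 'M[R]_n) u v w :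
  bform V w (u + v) = bform V w u + bform V w v.
Proof. by rewrite /bform raddfD /= mulmxDr mxE. Qed.

Lemma bformZl {n} (V : 'M[R]_n) a u v : bform V (a *: u) v = a * bform V u v.
Proof. by rewrite /bform -!scalemxAl mxE. Qed.

Lemma bformZr {n} (V : 'M[R]_n) a u v : bform V u (a *: v) = a * bform V u v.
Proof. by rewrite /bform linearZ /= -scalemxAr mxE. Qed.

Lemma bform_ge0 {n} (V : 'M[R]_n) u : posdef V -> 0 <= bform V u u.
Proof.
case=> _ Vpos; have [->|/Vpos/ltW//] := eqVneq u 0.
by rewrite /bform !mul0mx mxE.
Qed.

Lemma posdef_unit {n} (V : 'M[R]_n) : posdef V -> V \in unitmx.
Proof.
case=> _ Vpos; rewrite -row_free_unit -kermx_eq0; apply/negPn/negP => K0.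
have [u uK u0] := rowV0Pn K0.
have := Vpos _ u0; rewrite /bform.
by move/sub_kermxP: uK => ->; rewrite mul0mx mxE ltxx.
Qed.

(** The form is nonnegative at [bform V u u *: v - bform V u v *: u]; its value there is
    [bform V u u] times the difference of the two sides. *)
Lemma posdef_cauchy {n} (V : 'M[R]_n) u v : posdef V ->
  bform V u v ^+ 2 <= bform V u u * bform V v v.
Proof.
move=> Vpd; have [u0|u0] := eqVneq u 0.
  by rewrite /bform u0 !mul0mx mxE expr0n /= mul0r.
have uu : 0 < bform V u u by apply: Vpd.2.
have := bform_ge0 _ (bform V u u *: v + (- bform V u v) *: u) Vpd.
rewrite !bformDl !bformDr !bformZl !bformZr (bformC _ v u Vpd.1) => ge0.
rewrite -(ler_pM2l uu) -subr_ge0; apply: le_trans ge0 _.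
by rewrite le_eqVlt; apply/orP; left; apply/eqP; ring.
Qed.

(** Matrix determinant lemma: eliminating one or the other off-diagonal block of the bordered matrix
    [M] computes its determinant in two ways. *)
Lemma det_rank1_update {n} (V : 'M[R]_n) (x : 'rV[R]_n) :
  V \in unitmx ->
  \det (V + x^T *m x) = \det V * (1 + bform (invmx V) x x).
Proof.
move=> Vu; pose M := block_mx V (- x^T) x (1%:M : 'M[R]_1).
have detM1 : \det M = \det (V + x^T *m x).
  have : M *m block_mx (1%:M : 'M[R]_n) 0 (- x) (1%:M : 'M[R]_1)
      = block_mx (V + x^T *m x) (- x^T) 0 1%:M.
    by rewrite mulmx_block !mulmx1 !mulmx0 !mulmxN !mulNmx opprK mul1mx subrr !add0r.
  move/(congr1 determinant); rewrite det_mulmx det_lblock det_ublock !det1 !mulr1.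
  exact.
have : block_mx 1%:M 0 (- x *m invmx V) 1%:M *m M
    = block_mx V (- x^T) 0 (1%:M + x *m invmx V *m x^T).
  rewrite mulmx_block !mul1mx !mul0mx !addr0 -mulmxA mulVmx // mulmx1 addNr.
  by rewrite mulmxN !mulNmx opprK addrC.
move/(congr1 determinant); rewrite det_mulmx det_lblock det_ublock !det1 !mul1r.
by rewrite detM1 det_mx11 mxE [1%:M 0 0]mxE.
Qed.

Lemma posdef_drsubmx {n} (V : 'M[R]_(1 + n)) : posdef V -> posdef (drsubmx V).
Proof.
case=> Vsym Vpos; split=> [|u u0].
  by rewrite trmx_drsub Vsym.
have := Vpos (row_mx 0 u); rewrite -[V]submxK /bform mul_row_block.
rewrite !mul0mx !add0r tr_row_mx mul_row_col trmx0 mulmx0 add0r block_mxKdr.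
apply; apply: contra_neq u0 => /(congr1 rsubmx).
by rewrite row_mxKr => ->; apply/matrixP => i j; rewrite !mxE.
Qed.

(* Hadamard's inequality, by Schur complements: with [V = [a b; b^T V']], the
   complement [a - b V'^-1 b^T] is positive and at most [a]. *)
Lemma posdef_det {n} (V : 'M[R]_n) : posdef V ->
  0 < \det V <= \prod_i V i i.
Proof.
elim: n V => [|n IH] V Vpd; first by rewrite det_mx00 big_ord0 ltr01 lexx.
have V'pd : posdef (drsubmx (V : 'M[R]_(1 + n))) by exact: posdef_drsubmx.
pose V' := drsubmx (V : 'M[R]_(1 + n)); pose b := ursubmx (V : 'M[R]_(1 + n)).
pose a := ulsubmx (V : 'M[R]_(1 + n)).
have dlE : dlsubmx (V : 'M[R]_(1 + n)) = b^T.
  by rewrite trmx_ursub Vpd.1.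
have VE : V = block_mx a b b^T V' :> 'M[R]_(1 + n) by rewrite -dlE submxK.
have V'u := posdef_unit _ V'pd.
pose s : 'M[R]_1 := a - b *m invmx V' *m b^T.
have detV : \det V = s 0 0 * \det V'.
  have : block_mx 1%:M (- b *m invmx V') 0 1%:M *m block_mx a b b^T V' = block_mx s 0 b^T V'.
    rewrite mulmx_block !mul1mx !mul0mx !add0r.
    by rewrite -mulmxA -[_ *m invmx V' *m V']mulmxA mulVmx // mulmx1 subrr mulNmx mulmxA.
  move/(congr1 determinant); by rewrite -VE det_mulmx det_ublock !det1 !mul1r det_lblock det_mx11.
have invsym : (invmx V')^T = invmx V' by rewrite trmx_inv V'pd.1.
(* The complement subtracts from [a] the value of the form of [V'] at [b *m invmx V'], which is
   nonnegative. *)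
have schur_le : s 0 0 <= a 0 0.
  rewrite mxE [(- _ : 'M[R]_1) 0 0]mxE lerBlDr lerDl.
  have := bform_ge0 _ (b *m invmx V') V'pd; rewrite /bform.
  by rewrite -!mulmxA mulKmx // trmx_mul invsym.
(* The complement is also the value of the form of [V] at the nonzero vector [z]. *)
have schur_gt : 0 < s 0 0.
  pose z : 'rV[R]_(1 + n) := row_mx 1%:M (- (b *m invmx V')).
  have z0 : z != 0.
    apply/eqP => /(congr1 lsubmx); rewrite row_mxKl => /matrixP/(_ 0 0).
    by rewrite !mxE /= => /eqP; rewrite oner_eq0.
  have : 0 < (z *m block_mx a b b^T V' *m z^T) 0 0 by rewrite -VE; exact: Vpd.2.
  rewrite mul_row_block !mul1mx !mulNmx -[_ *m V']mulmxA mulVmx // mulmx1 subrr.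
  by rewrite tr_row_mx mul_row_col mul0mx addr0 trmx1 mulmx1.
have /andP[detgt detle] := IH _ V'pd.
rewrite detV mulr_gt0 //= big_ord_recl.
apply: ler_pM => //; try exact: ltW.
  by rewrite (_ : V ord0 ord0 = a 0 0) // !mxE; congr (V _ _); exact/val_inj.
apply: le_trans detle _; rewrite le_eqVlt; apply/orP; left; apply/eqP.
by apply: eq_bigr => i _; rewrite !mxE; congr (V _ _); exact/val_inj.
Qed.

End PositiveDefinite.

(** * Dot product of row vectors *)

Section DotProduct.
Context {R : realType} {n : nat}.
Implicit Types u v : 'rV[R]_n.

Definition dot u v : R := \sum_i u 0 i * v 0 i.

Lemma dot_bform1 u v : bform 1%:M u v = dot u v.
Proof.
rewrite /bform mulmx1 mxE; apply: eq_bigr => i _.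
by rewrite mxE.
Qed.

Lemma dot_ge0 u : 0 <= dot u u.
Proof. by apply: sumr_ge0 => i _; rewrite -expr2 sqr_ge0. Qed.

Lemma dot_gt0 u : u != 0 -> 0 < dot u u.
Proof.
move=> u0; rewrite lt_neqAle dot_ge0 andbT eq_sym; apply: contra_neq u0 => uu.
apply/rowP => i; rewrite mxE; apply/eqP; rewrite -sqrf_eq0; apply/eqP.
apply: (psumr_eq0P (F := fun j => u 0 j ^+ 2) (P := predT)) => //.
by move=> j _; exact: sqr_ge0.
Qed.

Lemma posdef1 : posdef (1%:M : 'M[R]_n).
Proof.
by split=> [|u u0]; [rewrite trmx1 | rewrite dot_bform1 dot_gt0].
Qed.

Lemma dot_cauchy u v : dot u v ^+ 2 <= dot u u * dot v v.
Proof. by rewrite -!dot_bform1; apply: posdef_cauchy posdef1. Qed.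

End DotProduct.

Lemma sum_sqr_le {R : realType} (T : nat) (a : nat -> R) :
  (\sum_(t < T) a t) ^+ 2 <= T%:R * \sum_(t < T) a t ^+ 2.
Proof.
have := dot_cauchy (const_mx 1) (\row_(t < T) a t).
rewrite /dot; under eq_bigr do rewrite !mxE mul1r.
under [X in _ <= X * _ -> _]eq_bigr do rewrite !mxE mul1r.
under [X in _ <= _ * X -> _]eq_bigr do rewrite !mxE -expr2.
by rewrite sumr_const card_ord.
Qed.

(** * The elliptical potential argument *)

Section EllipticalPotential.
Context {R : realType} {n : nat}.
Implicit Types (u v : 'rV[R]_n) (x : nat -> 'rV[R]_n).

(** The identity mirrors the term [frobenius Theta ^+ 2] of the confidence sets, so the quadratic
    form of this matrix is the norm they control. Indices start at 0 here: index [s] stands for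
    round [s.+1]. *)
Definition gram x t : 'M[R]_n := 1%:M + \sum_(s < t) (x s)^T *m x s.

Lemma gramS x t : gram x t.+1 = gram x t + (x t)^T *m x t.
Proof. by rewrite /gram big_ord_recr addrA. Qed.

Lemma bform_gramS x t u v :
  bform (gram x t.+1) u v = bform (gram x t) u v + dot u (x t) * dot v (x t).
Proof.
rewrite gramS /bform mulmxDr mulmxDl mxE; congr (_ + _).
rewrite mulmxA -mulmxA mxE big_ord1; congr (_ * _).
  by rewrite -dot_bform1 /bform mulmx1.
by rewrite mxE; apply: eq_bigr => i _; rewrite mxE mulrC.
Qed.

Lemma bform_gram x t u v :
  bform (gram x t) u v = dot u v + \sum_(s < t) dot u (x s) * dot v (x s).
Proof.
elim: t => [|t IH]; first by rewrite /gram !big_ord0 !addr0 dot_bform1.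
by rewrite bform_gramS IH big_ord_recr /= addrA.
Qed.

Lemma posdef_gram x t : posdef (gram x t).
Proof.
split=> [|u u0].
  rewrite /gram linearD /= trmx1 raddf_sum /=; congr (_ + _).
  by apply: eq_bigr => s _; rewrite trmx_mul trmxK.
rewrite bform_gram ltr_wpDr ?dot_gt0//.
by apply: sumr_ge0 => s _; rewrite -expr2 sqr_ge0.
Qed.

Lemma det_gramS x t :
  \det (gram x t.+1)
  = \det (gram x t) * (1 + bform (invmx (gram x t)) (x t) (x t)).
Proof. by rewrite gramS det_rank1_update// posdef_unit//; exact: posdef_gram. Qed.

Lemma det_gram_gt0 x t : 0 < \det (gram x t).
Proof. by have /andP[] := posdef_det _ (posdef_gram x t). Qed.

Lemma gram_pivot_gt0 x t : 0 < 1 + bform (invmx (gram x t)) (x t) (x t).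
Proof.
by have := det_gram_gt0 x t.+1; rewrite det_gramS pmulr_rgt0 ?det_gram_gt0.
Qed.

Lemma coord_sqr_le u i : u 0 i ^+ 2 <= dot u u.
Proof.
rewrite /dot (bigD1 i) //= -expr2 lerDl.
by apply: sumr_ge0 => j _; rewrite -expr2 sqr_ge0.
Qed.

Lemma gram_diag_le x t i : (forall s, (s < t)%N -> dot (x s) (x s) <= 1) ->
  gram x t i i <= 1 + t%:R.
Proof.
elim: t => [|t IH] x1.
  by rewrite /gram big_ord0 addr0 mxE eqxx addr0.
rewrite gramS mxE -natr1 addrA; apply: lerD.
  by apply: IH => s st; apply: x1; rewrite ltnW.
rewrite mxE big_ord1 mxE -expr2; apply: le_trans (x1 t _) => //.
exact: coord_sqr_le.
Qed.

(** Each argument of [ln] is a ratio of consecutive determinants, so the sum telescopes to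
    [ln (\det (gram x t))]; Hadamard's inequality then needs only the diagonal entries. *)
Lemma elliptical_potential x t : (forall s, (s < t)%N -> dot (x s) (x s) <= 1) ->
  \sum_(s < t) ln (1 + bform (invmx (gram x s)) (x s) (x s))
    <= n%:R * ln (1 + t%:R).
Proof.
move=> x1.
have -> : \sum_(s < t) ln (1 + bform (invmx (gram x s)) (x s) (x s))
    = ln (\det (gram x t)).
  elim: t {x1} => [|t IH].
    by rewrite big_ord0 /gram big_ord0 addr0 det1 ln1.
  by rewrite big_ord_recr /= IH det_gramS lnM// posrE ?det_gram_gt0 ?gram_pivot_gt0.
have tgt0 : 0 < 1 + t%:R :> R by rewrite ltr_pwDl.
apply: (@le_trans _ _ (ln ((1 + t%:R) ^+ n))).
  rewrite ler_ln ?posrE ?det_gram_gt0 ?exprn_gt0//.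
  have /andP[_ /le_trans] := posdef_det _ (posdef_gram x t); apply.
  rewrite -[X in _ <= _ ^+ X](card_ord n) -prodr_const.
  apply: ler_prod => i _; rewrite gram_diag_le// andbT.
  have := bform_ge0 _ (delta_mx 0 i) (posdef_gram x t).
  by rewrite /bform -rowE trmx_delta -colE !mxE.
by rewrite lnXn// mulr_natl.
Qed.

Lemma bform_invmx (V : 'M[R]_n) u : posdef V ->
  bform (invmx V) u u = bform V (u *m invmx V) (u *m invmx V).
Proof.
move=> Vpd; have Vu := posdef_unit _ Vpd.
by rewrite /bform mulmxKV// trmx_mul trmx_inv Vpd.1 mulmxA.
Qed.

(** Cauchy-Schwarz for the form of [gram x t], applied to [x t *m invmx (gram x t)] and [u]. *)
Lemma elliptical_width x t u :
  dot (x t) u ^+ 2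
  <= bform (invmx (gram x t)) (x t) (x t) * bform (gram x t) u u.
Proof.
have Vpd := posdef_gram x t.
rewrite bform_invmx// -dot_bform1.
have -> : bform 1%:M (x t) u = bform (gram x t) (x t *m invmx (gram x t)) u.
  by rewrite /bform mulmxKV ?mulmx1// posdef_unit.
exact: posdef_cauchy.
Qed.

(** Here [rho] is the instantaneous regret and [u] the error of the optimistic parameter.
    Cauchy-Schwarz over the rounds reduces the sum to squares, and each square is at most
    [8 * gamma] times one term of the elliptical potential. *)
Lemma optimistic_sum x (u : nat -> 'rV[R]_n) (rho : nat -> R) (gamma : R) T :
  1 <= gamma ->
  (forall t, (t < T)%N -> dot (x t) (x t) <= 1) ->
  (forall t, (t < T)%N -> 0 <= rho t <= 2) ->
  (forall t, (t < T)%N -> rho t <= dot (x t) (u t)) ->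
  (forall t, (t < T)%N -> bform (gram x t) (u t) (u t) <= 4 * gamma) ->
  \sum_(t < T) rho t
  <= Num.sqrt (T%:R * (8 * gamma * n%:R * ln (1 + T%:R))).
Proof.
move=> gamma1 x1 rho02 rhole ule.
have sum0 : 0 <= \sum_(t < T) rho t.
  by apply: sumr_ge0 => t _; have /andP[] := rho02 t (ltn_ord t).
rewrite -[leLHS]ger0_norm// -sqrtr_sqr ler_wsqrtr//.
apply: le_trans (sum_sqr_le _ _) _; rewrite ler_wpM2l//.
rewrite -mulrA; apply: le_trans (_ : 8 * gamma * _ <= _); last first.
  by apply: ler_wpM2l (elliptical_potential _ _ x1); lra.
rewrite mulr_sumr; apply: ler_sum => t _.
set q := bform _ _ _; have /andP[r0 r2] := rho02 t (ltn_ord t).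
have q0 : 0 <= q by rewrite /q bform_invmx ?bform_ge0//; exact: posdef_gram.
have rq : rho t ^+ 2 <= q * (4 * gamma).
  apply: le_trans (_ : dot (x t) (u t) ^+ 2 <= _).
    by rewrite lerXn2r ?nnegrE ?rhole// (le_trans r0)// rhole.
  by apply: le_trans (elliptical_width _ _ _) _; rewrite ler_wpM2l// ule.
(* This is [ln (1 + v) <= v] at [v = - q / (1 + q)], for which [1 + v] is the inverse of [1 + q]. *)
have ln_lb : q / (1 + q) <= ln (1 + q).
  have := @le_ln1Dx R (- (q / (1 + q))).
  have -> : 1 + - (q / (1 + q)) = (1 + q)^-1 by field; lra.
  rewrite lnV ?posrE; last lra.
  rewrite lerN2; apply.
  by rewrite ltrN2 ltr_pdivrMr; lra.
(* A small [q] uses the width bound [4 * gamma * q]; a large one uses [rho t <= 2] and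
   [1 <= gamma]. *)
have [q1|q1] := lerP q 1.
  have : q / 2 <= q / (1 + q) by rewrite ler_wpM2l// lef_pV2 ?posrE; lra.
  nra.
have : 1 / 2 <= q / (1 + q) by rewrite ler_pdivlMr; lra.
nra.
Qed.

End EllipticalPotential.

(** * The Frobenius inner product as a dot product in dimension [d1 * d2] *)

Section MatrixInnerProduct.
Context {R : realType} {d1 d2 : nat}.
Implicit Types A B C : 'M[R]_(d1, d2).

Lemma mxinnerE A B : mxinner A B = \sum_i \sum_j A i j * B i j.
Proof.
rewrite /mxinner /mxtrace exchange_big; apply: eq_bigr => j _.
by rewrite mxE; apply: eq_bigr => i _; rewrite mxE.
Qed.

Lemma mxinner_dot A B : mxinner A B = dot (mxvec A) (mxvec B).
Proof.
rewrite mxinnerE pair_bigA /dot (reindex _ (curry_mxvec_bij _ _)) /=.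
by apply: eq_bigr => -[i j] _; rewrite !mxvecE.
Qed.

Lemma mxinnerC A B : mxinner A B = mxinner B A.
Proof.
by rewrite !mxinnerE; apply: eq_bigr => i _; apply: eq_bigr => j _; rewrite mulrC.
Qed.

Lemma mxinnerBl A B C : mxinner (A - B) C = mxinner A C - mxinner B C.
Proof. by rewrite /mxinner linearB /= mulmxBl linearB. Qed.

Lemma mxinnerBr A B C : mxinner A (B - C) = mxinner A B - mxinner A C.
Proof. by rewrite mxinnerC mxinnerBl !(mxinnerC A). Qed.

Lemma mxinner_ge0 A : 0 <= mxinner A A.
Proof. by rewrite mxinner_dot dot_ge0. Qed.

Lemma frobenius_sqr A : frobenius A ^+ 2 = mxinner A A.
Proof. by rewrite sqr_sqrtr ?mxinner_ge0. Qed.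

Lemma frobenius_ge0 A : 0 <= frobenius A.
Proof. exact: sqrtr_ge0. Qed.

Lemma mxinner_subr_le A B :
  mxinner (A - B) (A - B) <= 2 * mxinner A A + 2 * mxinner B B.
Proof.
rewrite !mxinnerE !mulr_sumr -big_split /=; apply: ler_sum => i _.
rewrite !mulr_sumr -big_split /=; apply: ler_sum => j _; rewrite !mxE.
by have := sqr_ge0 (A i j + B i j); nra.
Qed.

Lemma mxinner_cauchy A B : `|mxinner A B| <= frobenius A * frobenius B.
Proof.
rewrite -(@ler_pXn2r _ 2)// ?nnegrE ?mulr_ge0 ?frobenius_ge0//.
by rewrite real_normK ?num_real// exprMn !frobenius_sqr !mxinner_dot dot_cauchy.
Qed.

Lemma mxinner_le1 A B : frobenius A <= 1 -> frobenius B <= 1 ->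
  `|mxinner A B| <= 1.
Proof.
move=> A1 B1; apply: le_trans (mxinner_cauchy _ _) _.
by rewrite -[leRHS]mulr1 ler_pM ?frobenius_ge0.
Qed.

End MatrixInnerProduct.

(** * Regret of the optimistic choice when the confidence sets contain the parameter *)

Section RegretOfOptimism.
Context {R : realType} {d1 d2 N : nat}.
Variables (net : 'I_N -> 'M[R]_(d1, d2)) (delta eta : R) (B : nat -> R).
Variables (X : nat -> 'M[R]_(d1, d2)) (y : nat -> R).

(** Merges the two branches of [conf_set]: the bound is 1 at time 0 and [1 + conf_radius] later, and
    [gamma] dominates both. *)
Lemma conf_set_le (gamma : R) t A : 1 <= gamma ->
  1 + conf_radius delta B t <= gamma -> conf_set net delta eta B X y t A ->
  mxinner A A + \sum_(s < t) (ew_prediction net eta X y s.+1 - mxinner A (X s.+1)) ^+ 2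
  <= gamma.
Proof.
move=> gamma1 betale; case: t betale => [_|t betale] /=.
  by rewrite big_ord0 addr0 frobenius_sqr => /le_trans; apply.
by rewrite big_add1 big_mkord frobenius_sqr => /le_trans; apply.
Qed.

(** Membership of [Theta] makes each confidence set nonempty, so the argmax clause applies, and
    comparison with [(Xstar, Theta)] bounds the regret of the round by the inner product of the
    pulled arm with [Thetat - Theta]. *)
Lemma lowloc_regret_le (arms : set 'M[R]_(d1, d2)) (T : nat)
    (Theta Xstar : 'M[R]_(d1, d2)) (Thetat : nat -> 'M[R]_(d1, d2)) (gamma : R) :
  1 <= gamma -> (forall t, 1 + conf_radius delta B t <= gamma) ->
  (forall A, arms A -> frobenius A <= 1) -> frobenius Theta <= 1 ->
  is_argmax arms (fun A => mxinner A Theta) Xstar ->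
  lowloc_run net delta eta B X y arms T Thetat ->
  (forall t, (t < T)%N -> conf_set net delta eta B X y t Theta) ->
  regret Theta Xstar X T
  <= Num.sqrt (T%:R * (8 * gamma * (d1 * d2)%:R * ln (1 + T%:R))).
Proof.
move=> gamma1 betale arms1 Theta1 [armXs Xsmax] run conf.
have run' t : (t < T)%N -> arms (X t.+1) /\
    is_argmax (arms `*` conf_set net delta eta B X y t)
      (fun p => mxinner p.1 p.2) (X t.+1, Thetat t.+1).
  move=> tT; have [|Xt opt] := run t.+1; first by rewrite ltnS.
  by split=> //; apply: opt; exists Theta; exact: conf.
rewrite /regret big_add1 big_mkord.
apply: (optimistic_sum (fun t => mxvec (X t.+1)) (fun t => mxvec (Thetat t.+1 - Theta))
   (fun t => mxinner (Xstar - X t.+1) Theta)) => // t tT;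
  have [armX [[_ /= confT] opt]] := run' t tT.
- by rewrite -mxinner_dot -frobenius_sqr exprn_ile1 ?frobenius_ge0 ?arms1.
- rewrite mxinnerBl subr_ge0 Xsmax//=.
  have := mxinner_le1 _ _ (arms1 _ armXs) Theta1.
  have := mxinner_le1 _ _ (arms1 _ armX) Theta1.
  rewrite !ler_norml; lra.
- rewrite -mxinner_dot mxinnerBl mxinnerBr lerD2r.
  by apply: (opt (Xstar, Theta)); split=> //=; exact: conf.
- rewrite bform_gram -mxinner_dot.
  have := conf_set_le _ _ _ gamma1 (betale t) confT.
  have := conf_set_le _ _ _ gamma1 (betale t) (conf t tT).
  have := mxinner_subr_le (Thetat t.+1) Theta.
  set S1 := \sum_(s < t) _; set S2 := \sum_(s < t) _ => leD hT hS.
  suff : \sum_(s < t) dot (mxvec (Thetat t.+1 - Theta)) (mxvec (X s.+1)) *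
      dot (mxvec (Thetat t.+1 - Theta)) (mxvec (X s.+1)) <= 2 * S1 + 2 * S2 by lra.
  rewrite !mulr_sumr -big_split /=; apply: ler_sum => s _.
  rewrite -mxinner_dot mxinnerBl.
  (* Both parameters are compared with the same prediction [a]: the square of [b - e] is at most
     twice the sum of the squares of [a - b] and [a - e]. *)
  set a := ew_prediction _ _ _ _ _; set b := mxinner _ _; set e := mxinner _ _.
  by have := sqr_ge0 ((a - b) + (a - e)); nra.
Qed.

End RegretOfOptimism.

(** * Integration against a factor that depends on [phi] only *)

Section IntegralAgainstFactor.
Context {d d' : measure_display} {Omega : measurableType d} {S : measurableType d'}.
Context {R : realType}.
Variables (P : {measure set Omega -> \bar R}) (phi : Omega -> S).
Hypothesis mphi : measurable_fun setT phi.

Import HBNNSimple.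
Local Open Scope ereal_scope.

(** The hypothesis is the case of indicators; simple functions follow by linearity, and general [H]
    by monotone convergence. In the application [phi] is the identity of [Omega] into the same set
    with the sigma-algebra of the past. *)
Lemma le_integral_factor (f : Omega -> R) (K : R) (H : S -> R) :
  measurable_fun setT f -> (forall w, 0 <= f w)%R -> (0 <= K)%R ->
  (forall A, measurable A ->
    \int[P]_(w in phi @^-1` A) (f w)%:E <= K%:E * P (phi @^-1` A)) ->
  measurable_fun setT H -> (forall w, 0 <= H w)%R ->
  \int[P]_w (H (phi w) * f w)%:E <= K%:E * \int[P]_w (H (phi w))%:E.
Proof.
move=> mf f0 K0 leA mH H0.
have mEH := (measurable_EFinP setT H).2 mH.
have EH0 v : setT v -> 0 <= (EFin \o H) v by rewrite /= lee_fin.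
pose h := nnsfun_approx measurableT mEH.
have mh n : measurable_fun setT (h n \o phi) by exact: measurableT_comp.
have h0 n w : (0 <= h n w)%R by [].
have hnd v : {homo (fun n => h n v) : a b / (a <= b)%N >-> (a <= b)%R}.
  by move=> a b ab; exact/lefP/nd_nnsfun_approx.
have hcvg v : (h n v)%:E @[n --> \oo] --> (H v)%:E.
  by have := @cvg_nnsfun_approx _ _ R setT measurableT (EFin \o H) mEH EH0 v I.
have hH n v : (h n v <= H v)%R.
  rewrite -lee_fin -(cvg_lim _ (hcvg v))//.
  apply: lime_ge; first by apply/cvg_ex; exists (H v)%:E.
  by near=> m; rewrite lee_fin hnd//; near: m; exact: nbhs_infty_ge.
have mA y n : measurable (phi @^-1` (h n @^-1` [set y])).
  rewrite -[X in measurable X]setTI; apply: mphi => //.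
have simple n : \int[P]_w (h n (phi w) * f w)%:E <= K%:E * \int[P]_w (h n (phi w))%:E.
  have mind y : measurable_fun setT (fun w => (y * \1_(h n @^-1` [set y]) (phi w))%R).
    by apply: measurable_funM => //; exact: (measurableT_comp _ mphi).
  have ind0 y w : (0 <= y * \1_(h n @^-1` [set y]) (phi w))%R.
    exact: nnfun_muleindic_ge0.
  (* Both integrals are split along the finitely many values of [h n]. *)
  have -> : \int[P]_w (h n (phi w) * f w)%:E = \sum_(y \in range (h n))
      \int[P]_w (y * \1_(h n @^-1` [set y]) (phi w) * f w)%:E.
    rewrite -ge0_integral_fsum//.
    - apply: eq_integral => w _; rewrite fimfunE fsumEFin//.
      by rewrite mulr_fsuml.
    - by move=> y; apply/measurable_EFinP; exact: measurable_funM.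
    - by move=> y w _; rewrite lee_fin mulr_ge0.
  have -> : \int[P]_w (h n (phi w))%:E = \sum_(y \in range (h n))
      \int[P]_w (y * \1_(h n @^-1` [set y]) (phi w))%:E.
    rewrite -ge0_integral_fsum//.
    - by apply: eq_integral => w _; rewrite fimfunE fsumEFin.
    - by move=> y; apply/measurable_EFinP.
    - by move=> y w _; rewrite lee_fin.
  rewrite ge0_mule_fsumr; last by move=> y; apply: integral_ge0 => w _; rewrite lee_fin.
  apply: lee_fsum => // y [v _ <-].
  under eq_integral do rewrite -mulrA EFinM.
  under [X in _ <= _ * X]eq_integral do rewrite EFinM.
  have mindv : measurable_fun setT
      (fun w => \1_(h n @^-1` [set h n v]) (phi w) : R).
    exact: (measurableT_comp _ mphi).
  have mindf : measurable_fun setT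
      (fun w => (\1_(h n @^-1` [set h n v]) (phi w) * f w)%R).
    exact: measurable_funM.
  rewrite !ge0_integralZl ?lee_fin//=; try exact/measurable_EFinP; last first.
    by move=> w _; rewrite lee_fin mulr_ge0.
  rewrite muleCA lee_wpmul2l ?lee_fin//.
  have -> : \int[P]_w (\1_(h n @^-1` [set h n v]) (phi w) * f w)%:E
      = \int[P]_(w in phi @^-1` (h n @^-1` [set h n v])) (f w)%:E.
    rewrite [RHS]integral_mkcond epatch_indic; apply: eq_integral => w _.
    by rewrite mulrC EFinM.
  have -> : \int[P]_w (\1_(h n @^-1` [set h n v]) (phi w))%:E
      = P (phi @^-1` (h n @^-1` [set h n v])).
    by rewrite -[in RHS](setIT (phi @^-1` _)) -integral_indic.
  exact: leA.
have mhf n : measurable_fun setT (fun w => (h n (phi w) * f w)%R).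
  by apply: measurable_funM => //; exact: mh.
apply: (@le_trans _ _ (limn (fun n => \int[P]_w (h n (phi w) * f w)%:E))).
  rewrite -monotone_convergence//.
  - rewrite le_eqVlt; apply/orP; left; apply/eqP; apply: eq_integral => w _.
    apply/esym/cvg_lim => //; under eq_fun do rewrite EFinM.
    rewrite EFinM; exact: cvgeZr.
  - by move=> n; apply/measurable_EFinP.
  - by move=> n w _; rewrite lee_fin; apply: mulr_ge0; [exact: h0|exact: f0].
  - by move=> w _ a b ab; rewrite lee_fin; apply: ler_wpM2r; [exact: f0|exact: hnd].
apply: lime_le.
  apply: ereal_nondecreasing_is_cvgn => a b ab; apply: ge0_le_integral => //.
  - by move=> w _; rewrite lee_fin; apply: mulr_ge0; [exact: h0|exact: f0].
  - by apply/measurable_EFinP; exact: mhf.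
  - by apply/measurable_EFinP; exact: mhf.
  - by move=> w _; rewrite lee_fin; apply: ler_wpM2r; [exact: f0|exact: hnd].
near=> n; apply: le_trans (simple n) _; rewrite lee_wpmul2l ?lee_fin//.
apply: ge0_le_integral => //.
- by move=> w _; rewrite lee_fin.
- by apply/measurable_EFinP; exact: mh.
- by apply/measurable_EFinP; exact: measurableT_comp.
- by move=> w _; rewrite lee_fin.
Unshelve. all: by end_near. Qed.

End IntegralAgainstFactor.

(** * Expectations of nonnegative functions *)

Section NonnegativeExpectation.
Context {d : measure_display} {Omega : measurableType d} {R : realType}.
Variable P : {measure set Omega -> \bar R}.
Implicit Types f g : Omega -> R.

(** Extended-real values let monotonicity and additivity hold for nonnegative measurable functions
    without any integrability side condition. *)
Definition ge0_expect (f : Omega -> R) : \bar R := (\int[P]_w (f w)%:E)%E.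

Lemma le_ge0_expect f g : measurable_fun setT f -> measurable_fun setT g ->
  (forall w, 0 <= f w) -> (forall w, f w <= g w) ->
  (ge0_expect f <= ge0_expect g)%E.
Proof.
move=> mf mg f0 fg; apply: ge0_le_integral => //.
- by move=> w _; rewrite lee_fin.
- exact/measurable_EFinP.
- by apply/measurable_EFinP.
- by move=> w _; rewrite lee_fin.
Qed.

Lemma ge0_expectD f g : measurable_fun setT f -> measurable_fun setT g ->
  (forall w, 0 <= f w) -> (forall w, 0 <= g w) ->
  ge0_expect (fun w => f w + g w) = (ge0_expect f + ge0_expect g)%E.
Proof.
move=> mf mg f0 g0; rewrite /ge0_expect -ge0_integralD//.
- by move=> w _; rewrite lee_fin.
- exact/measurable_EFinP.
- by move=> w _; rewrite lee_fin.
- exact/measurable_EFinP.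
Qed.

Lemma ge0_expectZ k f : measurable_fun setT f ->
  (forall w, 0 <= f w) -> 0 <= k ->
  ge0_expect (fun w => k * f w) = (k%:E * ge0_expect f)%E.
Proof.
move=> mf f0 k0; rewrite /ge0_expect.
under eq_integral do rewrite EFinM.
rewrite ge0_integralZl ?lee_fin//.
- exact/measurable_EFinP.
- by move=> w _; rewrite lee_fin.
Qed.

Lemma ge0_expect_sum (I : Type) (s : seq I) (f : I -> Omega -> R) :
  (forall i, measurable_fun setT (f i)) -> (forall i w, 0 <= f i w) ->
  ge0_expect (fun w => \sum_(i <- s) f i w) = (\sum_(i <- s) ge0_expect (f i))%E.
Proof.
move=> mf f0; rewrite /ge0_expect -ge0_integral_sum//.
- by apply: eq_integral => w _; rewrite sumEFin.
- by move=> i; apply/measurable_EFinP.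
- by move=> i w _; rewrite lee_fin.
Qed.

End NonnegativeExpectation.

Notation "\E0[ P ]_ w f" := (ge0_expect P (fun w => f%R))
  (at level 10, w name, f at level 9).

(** Convexity from the tangent at [z]: it lies below [expR] at [x] and at [y], and the linear terms
    cancel in the average. *)
Lemma expR_chord {R : realType} (t x y : R) : 0 <= t <= 1 ->
  expR (t * x + (1 - t) * y) <= t * expR x + (1 - t) * expR y.
Proof.
move=> /andP[t0 t1]; set z := t * x + _.
have tangent u : expR z * (1 + (u - z)) <= expR u.
  have -> : expR u = expR z * expR (u - z) by rewrite -expRD; congr expR; ring.
  by rewrite ler_wpM2l ?expR_ge0 ?expR_ge1Dx.
have := ler_wpM2l t0 (tangent x).
have t1' : 0 <= 1 - t by lra.
have := ler_wpM2l t1' (tangent y); rewrite /z; nra.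
Qed.

Ltac solve_meas :=
  repeat (try assumption;
  lazymatch goal with
  | |- measurable_fun _ (fun _ => ?c) => exact: measurable_cst
  | |- measurable_fun _ (fun x => @?f x - @?g x) => apply: (measurable_funB (f := f) (g := g))
  | |- measurable_fun _ (fun x => @?f x + @?g x) => apply: (measurable_funD (f := f) (g := g))
  | |- measurable_fun _ (fun x => @?f x * @?g x) => apply: (measurable_funM (f := f) (g := g))
  | |- measurable_fun _ (fun x => @?f x ^+ _) => apply: (measurable_funX (f := f))
  | |- measurable_fun _ (fun x => expR (@?f x)) =>
      apply: (measurableT_comp (@measurable_expR _) (g := f))
  end).

(** * Sub-Gaussian bounds for an exponent that is a function of the past *)

Section RandomExponent.
Context {d d' : measure_display} {Omega : measurableType d} {S : measurableType d'}.
Context {R : realType}.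
Variables (P : {measure set Omega -> \bar R}) (phi : Omega -> S).
Hypothesis mphi : measurable_fun setT phi.
Variable noise : Omega -> R.
Hypothesis mnoise : measurable_fun setT noise.
Hypothesis subg : forall (lambda : R) (A : set S), measurable A ->
  (\int[P]_(w in phi @^-1` A) (expR (lambda * noise w))%:E
   <= (expR (lambda ^+ 2 / 2))%:E * P (phi @^-1` A))%E.
Variable Lambda : S -> R.
Hypothesis mLambda : measurable_fun setT Lambda.

Lemma subgaussian_const (lambda : R) (H : S -> R) :
  measurable_fun setT H -> (forall v, 0 <= H v) ->
  (\E0[P]_w (H (phi w) * expR (lambda * noise w))
   <= \E0[P]_w (expR (lambda ^+ 2 / 2) * H (phi w)))%E.
Proof.
move=> mH H0; rewrite ge0_expectZ ?expR_ge0//; last exact: measurableT_comp.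
apply: (le_integral_factor P phi mphi (fun w => expR (lambda * noise w))) => //.
- by solve_meas.
- exact: subg.
Qed.

(* On a short range of exponents the exponential is bounded by its chord, whose
   coefficients are functions of [phi] and whose nodes are constants. *)
Lemma subgaussian_chord (H : S -> R) (a eps : R) : 0 < eps ->
  measurable_fun setT H -> (forall v, 0 <= H v) ->
  (forall v, H v != 0 -> a <= Lambda v <= a + eps) ->
  (\E0[P]_w (H (phi w) * expR (Lambda (phi w) * noise w))
   <= \E0[P]_w (H (phi w) * expR (Lambda (phi w) ^+ 2 + eps ^+ 2)))%E.
Proof.
move=> eps0 mH H0 Hrange.
pose t v := (a + eps - Lambda v) / eps.
have t01 v : H v != 0 -> 0 <= t v <= 1.
  move=> /Hrange ?; rewrite /t ler_pdivlMr// ler_pdivrMr//; lra.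
have LE v : Lambda v = t v * a + (1 - t v) * (a + eps).
  by rewrite /t; field; lra.
have mt : measurable_fun setT t by by rewrite /t; solve_meas.
clearbody t.
have mHt : measurable_fun setT (fun v => H v * t v) by solve_meas.
have mHt' : measurable_fun setT (fun v => H v * (1 - t v)) by solve_meas.
(* Off the support of [H] the coefficient [t] may leave the unit interval, but the product is then
   0. *)
have Ht0 v : 0 <= H v * t v.
  by have [->|/t01/andP[? ?]] := eqVneq (H v) 0; rewrite ?mul0r// mulr_ge0.
have Ht'0 v : 0 <= H v * (1 - t v).
  by have [->|/t01/andP[? ?]] := eqVneq (H v) 0; rewrite ?mul0r// mulr_ge0// subr_ge0.
have mcomp (f : S -> R) : measurable_fun setT f -> measurable_fun setT (fun w => f (phi w)).
  by move=> mf; exact: (measurableT_comp mf mphi).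
have := mcomp _ mH; have := mcomp _ mLambda; have := mcomp _ mHt; have := mcomp _ mHt'.
move=> mHt'p mHtp mLp mHp.
apply: (@le_trans _ _ (\E0[P]_w (H (phi w) * t (phi w) * expR (a * noise w)
    + H (phi w) * (1 - t (phi w)) * expR ((a + eps) * noise w)))).
  apply: le_ge0_expect; [by solve_meas|by solve_meas| |] => w.
    by rewrite mulr_ge0 ?expR_ge0.
  have [->|Hn0] := eqVneq (H (phi w)) 0; first by rewrite !mul0r addr0.
  rewrite -!mulrA -mulrDr ler_wpM2l// {1}LE mulrDl -!mulrA.
  exact/expR_chord/t01.
rewrite ge0_expectD; [|by solve_meas|by solve_meas| |]; last 2 first.
- by move=> w; rewrite mulr_ge0 ?expR_ge0.
- by move=> w; rewrite mulr_ge0 ?expR_ge0.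
apply: le_trans (leeD (subgaussian_const a _ mHt Ht0) (subgaussian_const (a + eps) _ mHt' Ht'0)) _.
rewrite -ge0_expectD; [|by solve_meas|by solve_meas| |]; last 2 first.
- by move=> w; rewrite mulr_ge0 ?expR_ge0.
- by move=> w; rewrite mulr_ge0 ?expR_ge0.
apply: le_ge0_expect; [by solve_meas|by solve_meas| |] => w.
  by apply: addr_ge0; apply: mulr_ge0 (expR_ge0 _) _.
have [->|Hn0] := eqVneq (H (phi w)) 0; first by rewrite !(mul0r, mulr0) addr0.
have /andP[l1 l2] := Hrange _ Hn0.
(* Replacing the node [u] by [Lambda] costs a factor 2 in the exponent: half of [u ^+ 2] is at most
   [Lambda ^+ 2] plus the square of [u - Lambda]. *)
have node_le u : `|u - Lambda (phi w)| <= eps ->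
    expR (u ^+ 2 / 2) <= expR (Lambda (phi w) ^+ 2 + eps ^+ 2).
  move=> ule; rewrite ler_expR.
  have : (u - Lambda (phi w)) ^+ 2 <= eps ^+ 2.
    by rewrite -real_normK ?num_real// lerXn2r// nnegrE ltW.
  by have := sqr_ge0 (u - 2 * Lambda (phi w)); nra.
have ea : expR (a ^+ 2 / 2) <= expR (Lambda (phi w) ^+ 2 + eps ^+ 2).
  by apply: node_le; rewrite ler_norml; lra.
have eb : expR ((a + eps) ^+ 2 / 2) <= expR (Lambda (phi w) ^+ 2 + eps ^+ 2).
  by apply: node_le; rewrite ler_norml; lra.
have := ler_wpM2r (Ht0 (phi w)) ea; have := ler_wpM2r (Ht'0 (phi w)) eb.
lra.
Qed.

(** Induction on the number of cells of width [eps]: the indicator [iA] splits off the last cell.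
    The expectations over the cells add up exactly, so the error does not grow with [k]. *)
Lemma subgaussian_range k (H : S -> R) (a eps : R) : 0 < eps ->
  measurable_fun setT H -> (forall v, 0 <= H v) ->
  (forall v, H v != 0 -> a <= Lambda v <= a + k.+1%:R * eps) ->
  (\E0[P]_w (H (phi w) * expR (Lambda (phi w) * noise w))
   <= \E0[P]_w (H (phi w) * expR (Lambda (phi w) ^+ 2 + eps ^+ 2)))%E.
Proof.
move=> eps0; elim: k H => [|k IH] H mH H0 Hrange.
  by apply: (subgaussian_chord _ a) => // v /Hrange; rewrite mul1r.
pose A : set S := [set v | Lambda v <= a + k.+1%:R * eps].
have mA : measurable A.
  rewrite -[A]setTI; exact: measurable_fun_le.
pose iA v : R := \1_A v.
have miA : measurable_fun setT iA by exact: measurable_indic.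
have iA01 v : 0 <= iA v <= 1 by rewrite /iA indicE; case: (v \in A); rewrite ?lexx ler01.
have mcomp (f : S -> R) : measurable_fun setT f -> measurable_fun setT (fun w => f (phi w)).
  by move=> mf; exact: (measurableT_comp mf mphi).
have mH1 : measurable_fun setT (fun v => H v * iA v) by solve_meas.
have mH2 : measurable_fun setT (fun v => H v * (1 - iA v)) by solve_meas.
have H10 v : 0 <= H v * iA v by case/andP: (iA01 v) => ? ?; rewrite mulr_ge0// ?subr_ge0.
have H20 v : 0 <= H v * (1 - iA v) by case/andP: (iA01 v) => ? ?; rewrite mulr_ge0// ?subr_ge0.
have split_expect (e : Omega -> R) : measurable_fun setT e -> (forall w, 0 <= e w) ->
    \E0[P]_w (H (phi w) * e w) = (\E0[P]_w (H (phi w) * iA (phi w) * e w)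
      + \E0[P]_w (H (phi w) * (1 - iA (phi w)) * e w))%E.
  move=> me e0; have := mcomp _ mH1; have := mcomp _ mH2 => m2 m1.
  rewrite -ge0_expectD; [|by solve_meas|by solve_meas| |]; last 2 first.
  - by move=> w; rewrite mulr_ge0.
  - by move=> w; rewrite mulr_ge0.
  by congr ge0_expect; apply/funext => w; ring.
have mL := mcomp _ mLambda.
rewrite split_expect; [|by solve_meas|by move=> w; exact: expR_ge0].
rewrite [leRHS]split_expect; last 2 first.
- by solve_meas.
- by move=> w; exact: expR_ge0.
apply: leeD; first apply: (IH _ mH1 H10) => v.
  rewrite /iA indicE; have [vA|_] := boolP (v \in A); last by rewrite mulr0 eqxx.
  by rewrite mulr1 => /Hrange /andP[-> _]; move: vA; rewrite inE.
apply: (subgaussian_chord (fun v => H v * (1 - iA v)) (a + k.+1%:R * eps) eps) => // v.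
rewrite /iA indicE; have [_|vA] := boolP (v \in A); first by rewrite subrr mulr0 eqxx.
rewrite subr0 mulr1 => /Hrange /andP[_ h].
move: vA; rewrite notin_setE /A /= => /negP; rewrite -ltNge => /ltW -> /=.
by move: h; rewrite -natr1; nra.
Qed.

(** The interval from -1 to 1 is covered by [2 * m] cells of width [1 / m]. *)
Lemma subgaussian_le (H : S -> R) (m : nat) : (0 < m)%N ->
  measurable_fun setT H -> (forall v, 0 <= H v) ->
  (forall v, `|Lambda v| <= 1) ->
  (\E0[P]_w (H (phi w) * expR (Lambda (phi w) * noise w))
   <= \E0[P]_w (H (phi w) * expR (Lambda (phi w) ^+ 2 + m%:R^-1 ^+ 2)))%E.
Proof.
move=> m0 mH H0 L1.
have range v : H v != 0 -> -1 <= Lambda v <= -1 + (2 * m).-1.+1%:R * m%:R^-1.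
  move=> _; have := L1 v; rewrite ler_norml => /andP[-> L] /=.
  by rewrite prednK ?muln_gt0// natrM mulfK ?pnatr_eq0 -?lt0n//; lra.
by apply: subgaussian_range range => //; rewrite invr_gt0 ltr0n.
Qed.

End RandomExponent.

(** * Scalar inequalities for exponentials and their mixtures *)

Section ExponentialInequalities.
Context {R : realType}.
Implicit Types x m v rho : R.

(** Inverting [1 - v <= expR (- v)] leaves a rational inequality, whose two sides differ by
    [v ^+ 2 * (1 - 2 * v)] after multiplication by [1 - v]. *)
Lemma expR_le_quadratic v : v <= 1 / 2 -> expR v <= 1 + v + 2 * v ^+ 2.
Proof.
move=> v_le; have := expR_ge1Dx (- v); rewrite expRN => inv_ge.
have inv_gt : 0 < (expR v)^-1 by rewrite invr_gt0 expR_gt0.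
have -> : expR v = (expR v)^-1^-1 by rewrite invrK.
apply: (@le_trans _ _ (1 - v)^-1); first by rewrite lef_pV2// posrE; lra.
rewrite -[_^-1]mul1r ler_pdivrMr; last lra.
have : 0 <= v ^+ 2 * (1 - 2 * v) by rewrite mulr_ge0 ?sqr_ge0//; lra.
lra.
Qed.

(* The tangent at [m] of the concave branch of [x |-> exp (- x^2 / 32)]. *)
Lemma expR_sqr_tangent x m : `|x| <= 2 -> `|m| <= 2 ->
  expR ((m ^+ 2 - x ^+ 2) / 32) <= 1 - m / 16 * (x - m).
Proof.
rewrite !ler_norml => /andP[x1 x2] /andP[m1 m2].
have := expR_le_quadratic ((m ^+ 2 - x ^+ 2) / 32).
have -> : (m ^+ 2 - x ^+ 2) / 32 = - ((x - m) * (x + m)) / 32 by ring.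
set e := expR _ => he.
have sx : (x + m) ^+ 2 <= 16 by nra.
have {}he : e <= 1 + - ((x - m) * (x + m)) / 32 + 2 * (- ((x - m) * (x + m)) / 32) ^+ 2.
  apply: he; nra.
apply: le_trans he _.
(* Writing [x + m = 2 * m + (x - m)], the first-order term contains minus the square of [x - m] over
   32, which pays exactly for the quadratic term. *)
have : 0 <= (x - m) ^+ 2 * (16 - (x + m) ^+ 2).
  by rewrite mulr_ge0 ?sqr_ge0 ?subr_ge0.
have := sqr_ge0 (x - m); nra.
Qed.

(** Bernoulli's inequality for the real power [rho] of [expR x]: the chord of [expR] between
    [rho * x] and 0, with weight [1 / rho]. *)
Lemma expR_bernoulli rho x : 1 <= rho -> 1 + rho * (expR x - 1) <= expR (rho * x).
Proof.
move=> rho1; have rho0 : 0 < rho by lra.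
have /expR_chord : 0 <= rho^-1 <= 1 by rewrite invr_ge0 ltW//= invf_le1.
move=> /(_ (rho * x) 0); rewrite mulr0 addr0 mulKf ?gt_eqF// expR0 mulr1.
move=> /(ler_wpM2l (ltW rho0)); rewrite mulrDr mulVKf ?gt_eqF//.
by rewrite mulrBr mulr1 divff ?gt_eqF//; lra.
Qed.

(** Jensen for the power [rho], written through [ln]. Once the mean is normalized to 1, Bernoulli
    applies termwise and the linear terms average to 0. *)
Lemma jensen_expR_power (I : finType) (p u : I -> R) rho : 1 <= rho ->
  (forall i, 0 <= p i) -> \sum_i p i = 1 -> 0 < \sum_i p i * expR (u i) ->
  expR (rho * ln (\sum_i p i * expR (u i))) <= \sum_i p i * expR (rho * u i).
Proof.
move=> rho1 p0 p1; set a := \sum_i _ => a0.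
have -> : \sum_i p i * expR (rho * u i)
    = expR (rho * ln a) * \sum_i p i * expR (rho * (u i - ln a)).
  rewrite mulr_sumr; apply: eq_bigr => i _.
  by rewrite mulrCA -expRD; congr (_ * expR _); ring.
rewrite -[leLHS]mulr1 ler_wpM2l ?expR_ge0//.
apply: (@le_trans _ _ (\sum_i p i * (1 + rho * (expR (u i) / a - 1)))).
  have -> : \sum_i p i * (1 + rho * (expR (u i) / a - 1)) =
      (1 - rho) * (\sum_i p i) + rho / a * a.
    rewrite /a !mulr_sumr -big_split /=; apply: eq_bigr => i _; ring.
  by rewrite p1 divfK ?gt_eqF//; lra.
apply: ler_sum => i _; rewrite ler_wpM2l//.
have -> : expR (u i) / a = expR (u i - ln a) by rewrite expRB lnK ?posrE.
exact: expR_bernoulli.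
Qed.

(** Here [D] are the deviations of the net points, [D0] that of the reference point, and the last
    exponential is the price of integrating out the noise. Each total exponent is at most
    [(m ^+ 2 - D i ^+ 2) / 32], and the tangent bound at the mean [m] has a linear term of mean
    0. *)
Lemma mixture_le1 (I : finType) (p D : I -> R) (D0 tau : R) :
  (forall i, 0 <= p i) -> \sum_i p i = 1 -> (forall i, `|D i| <= 2) ->
  D0 ^+ 2 <= tau ->
  let m := \sum_i p i * D i in
  \sum_i expR (m ^+ 2 / 32 - 2 * tau) * (p i * expR ((D0 ^+ 2 - D i ^+ 2) / 16))
    * expR (((D i - D0) / 8) ^+ 2 + tau) <= 1.
Proof.
move=> p0 p1 D2 D0le; set m := \sum_i p i * D i; cbv zeta.
have mE : \sum_i p i * D i = m by [].
have m2 : `|m| <= 2.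
  apply: le_trans (ler_norm_sum _ _ _) _.
  have -> : 2 = \sum_i p i * 2 :> R by rewrite -mulr_suml p1 mul1r.
  by apply: ler_sum => i _; rewrite normrM ger0_norm// ler_wpM2l.
clearbody m.
apply: (@le_trans _ _ (\sum_i p i * (1 - m / 16 * (D i - m)))); last first.
  have -> : \sum_i p i * (1 - m / 16 * (D i - m))
      = (1 + m / 16 * m) * (\sum_i p i) - m / 16 * \sum_i p i * D i.
    rewrite !mulr_sumr -sumrB; apply: eq_bigr => i _; ring.
  by rewrite p1 mE; lra.
apply: ler_sum => i _; rewrite [X in X * _ <= _]mulrCA -[X in X <= _]mulrA.
apply: ler_wpM2l => //.
apply: le_trans (expR_sqr_tangent _ _ (D2 i) m2).
rewrite -!expRD ler_expR.
(* The square of [D i - D0] is at most [2 * D i ^+ 2 + 2 * D0 ^+ 2]; the leftover multiple [3 / 32]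
   of [D0 ^+ 2] is absorbed by [tau]. *)
by have := sqr_ge0 (D i + D0); nra.
Qed.

End ExponentialInequalities.

(** * The exponential-weights potential along one realization *)

Section ExponentialWeights.
Context {R : realType} {d1 d2 N : nat}.
Variables (net : 'I_N -> 'M[R]_(d1, d2)) (eta : R).
Variables (Theta : 'M[R]_(d1, d2)) (i0 : 'I_N) (tau : R).
Variables (X : nat -> 'M[R]_(d1, d2)) (y : nat -> R).

Definition ew_weight t i : R :=
  expR (- eta * cum_loss net X y i t.-1) /
  \sum_(j < N) expR (- eta * cum_loss net X y j t.-1).

Definition ew_error t : R := ew_prediction net eta X y t - mxinner (X t) Theta.

Definition excess_loss t i : R :=
  (y t - mxinner (X t) (net i)) ^+ 2 - (y t - mxinner (X t) (net i0)) ^+ 2.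

(* The conditional expectation of each factor given the past and [X t] is at
   most 1; the exponent 1/16 does not depend on [eta]. *)
Definition ew_factor t : R :=
  expR (ew_error t ^+ 2 / 32 - 2 * tau) *
  \sum_i ew_weight t i * expR (- excess_loss t i / 16).

Definition ew_potential t : R := \prod_(1 <= s < t.+1) ew_factor s.

Let dev t i := mxinner (X t) (net i) - mxinner (X t) Theta.

(** The part of the [i]-th term of [ew_factor] that is known before the noise of round [t];
    [ew_exponent] is the coefficient of that noise in the exponent. *)
Definition ew_coeff t i : R :=
  expR (ew_error t ^+ 2 / 32 - 2 * tau) *
  (ew_weight t i * expR ((dev t i0 ^+ 2 - dev t i ^+ 2) / 16)).

Definition ew_exponent t i : R := (dev t i - dev t i0) / 8.

Lemma weight_sum_gt0 t : 0 < \sum_(j < N) expR (- eta * cum_loss net X y j t).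
Proof.
rewrite (bigD1 i0) //= ltr_wpDr ?expR_gt0//.
by apply: sumr_ge0 => i _; rewrite expR_ge0.
Qed.

Lemma ew_weight_ge0 t i : 0 <= ew_weight t i.
Proof. by rewrite divr_ge0 ?expR_ge0// ltW// weight_sum_gt0. Qed.

Lemma sum_ew_weight t : \sum_i ew_weight t i = 1.
Proof. by rewrite -mulr_suml divff// gt_eqF// weight_sum_gt0. Qed.

Lemma ew_predictionE t :
  ew_prediction net eta X y t = \sum_i ew_weight t i * mxinner (X t) (net i).
Proof.
by rewrite /ew_prediction mulr_suml; apply: eq_bigr => i _; rewrite mulrAC.
Qed.

Lemma ew_errorE t : ew_error t = \sum_i ew_weight t i * dev t i.
Proof.
rewrite /ew_error ew_predictionE /dev.
under [RHS]eq_bigr do rewrite mulrBr.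
by rewrite sumrB -mulr_suml sum_ew_weight mul1r.
Qed.

(** The square of the noise cancels in [excess_loss], so every exponent is affine in the noise. *)
Lemma ew_factorE t :
  ew_factor t = \sum_i ew_coeff t i *
    expR (ew_exponent t i * (y t - mxinner (X t) Theta)).
Proof.
rewrite /ew_factor mulr_sumr; apply: eq_bigr => i _.
rewrite /ew_coeff -[RHS]mulrA -[X in _ = _ * X]mulrA -expRD.
congr (_ * (_ * expR _)).
by rewrite /excess_loss /ew_exponent /dev; field.
Qed.

Lemma ew_factor_ge0 t : 0 <= ew_factor t.
Proof.
rewrite mulr_ge0 ?expR_ge0//; apply: sumr_ge0 => i _.
by rewrite mulr_ge0 ?expR_ge0 ?ew_weight_ge0.
Qed.

Lemma ew_potential_ge0 t : 0 <= ew_potential t.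
Proof. by apply: prodr_ge0 => s _; exact: ew_factor_ge0. Qed.

Lemma ew_coeff_ge0 t i : 0 <= ew_coeff t i.
Proof.
apply: mulr_ge0 (expR_ge0 _) _.
by apply: mulr_ge0 (expR_ge0 _); exact: ew_weight_ge0.
Qed.

Lemma ew_potentialS t : ew_potential t.+1 = ew_potential t * ew_factor t.+1.
Proof. by rewrite /ew_potential big_nat_recr. Qed.

(** The prediction error is the weighted mean of the deviations, which makes this an instance of
    [mixture_le1]. *)
Lemma sum_ew_coeff_le1 t : (forall i, `|dev t i| <= 2) -> dev t i0 ^+ 2 <= tau ->
  \sum_i ew_coeff t i * expR (ew_exponent t i ^+ 2 + tau) <= 1.
Proof.
move=> dev2 dev0; rewrite /ew_coeff ew_errorE.
exact: (mixture_le1 _ _ _ _ _ (ew_weight_ge0 t) (sum_ew_weight t) dev2 dev0).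
Qed.

(** At the rate [eta] of the weights, each mixture is a ratio of consecutive normalizing sums times
    the loss factor of [i0]; the product telescopes down to the initial sum [N]. *)
Lemma prod_mix_loss t :
  \prod_(1 <= s < t.+1) (\sum_i ew_weight s i * expR (- eta * excess_loss s i))
  = expR (eta * cum_loss net X y i0 t) *
    (\sum_i expR (- eta * cum_loss net X y i t)) / N%:R.
Proof.
elim: t => [|t IH].
  have loss0 i : cum_loss net X y i 0 = 0 by rewrite /cum_loss big_geq.
  rewrite big_geq//; under [in RHS]eq_bigr do rewrite loss0 mulr0 expR0.
  rewrite loss0 mulr0 expR0 mul1r sumr_const card_ord divff//.
  by rewrite pnatr_eq0 -lt0n (leq_trans _ (ltn_ord i0)).
rewrite big_nat_recr//= {}IH.
have Wn0 := gt_eqF (weight_sum_gt0 t).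
have -> : \sum_i ew_weight t.+1 i * expR (- eta * excess_loss t.+1 i)
    = (\sum_i expR (- eta * cum_loss net X y i t.+1))
      * expR (eta * (y t.+1 - mxinner (X t.+1) (net i0)) ^+ 2)
      / \sum_(j < N) expR (- eta * cum_loss net X y j t).
  rewrite !mulr_suml; apply: eq_bigr => i _.
  rewrite /ew_weight mulrAC -!expRD; congr (expR _ / _).
  by rewrite /excess_loss /cum_loss /= [in RHS]big_nat_recr//=; ring.
have -> : expR (eta * cum_loss net X y i0 t.+1) = expR (eta * cum_loss net X y i0 t)
    * expR (eta * (y t.+1 - mxinner (X t.+1) (net i0)) ^+ 2).
  by rewrite -expRD /cum_loss big_nat_recr//= mulrDr.
field.
by rewrite Wn0 pnatr_eq0 -lt0n (leq_trans _ (ltn_ord i0)).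
Qed.

(** The potential uses the rate [1 / 16] and the weights the smaller rate [eta]. Jensen for the
    power [rho] passes from one to the other in each round, after which the product at rate [eta]
    telescopes. *)
Lemma ew_potential_ge (rho : R) t : 1 <= rho -> eta = (16 * rho)^-1 ->
  expR ((\sum_(1 <= s < t.+1) ew_error s ^+ 2) / 32 - 2 * tau * t%:R - rho * ln N%:R)
  <= ew_potential t.
Proof.
move=> rho1 etaE.
pose mix s := \sum_i ew_weight s i * expR (- eta * excess_loss s i).
have mix_gt0 s : 0 < mix s.
  rewrite /mix (bigD1 i0)//= ltr_wpDr//; last first.
    by rewrite mulr_gt0 ?expR_gt0// divr_gt0 ?expR_gt0 ?weight_sum_gt0.
  by apply: sumr_ge0 => i _; rewrite mulr_ge0 ?expR_ge0 ?ew_weight_ge0.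
have mix_prod_gt0 u : 0 < \prod_(1 <= s < u) mix s by apply: prodr_gt0.
have N0 : 0 < N%:R :> R by rewrite ltr0n (leq_trans _ (ltn_ord i0)).
apply: (@le_trans _ _ (expR ((\sum_(1 <= s < t.+1) ew_error s ^+ 2) / 32
    - 2 * tau * t%:R + rho * ln (\prod_(1 <= s < t.+1) mix s)))).
  rewrite ler_expR lerD2l -mulrN ler_wpM2l//; first lra.
  rewrite -lnV// ler_ln ?posrE ?invr_gt0// prod_mix_loss.
  rewrite -[leLHS]mul1r ler_wpM2r// ?invr_ge0 ?ler0n//.
  (* Keeping only the term of [i0] bounds the telescoped product below by [1 / N]. *)
  rewrite (bigD1 i0)//= mulrDr -expRD mulNr subrr expR0 lerDl.
  by rewrite mulr_ge0 ?expR_ge0//; apply: sumr_ge0 => i _; rewrite expR_ge0.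
elim: t => [|t IH].
  by rewrite /ew_potential !big_geq// ln1 mulr0 mul0r mulr0 subr0 addr0 expR0.
rewrite ew_potentialS big_nat_recr//= [in ln _]big_nat_recr//= lnM ?posrE//.
set S := \sum_(1 <= s < t.+1) _ in IH *; set L := ln _ in IH *.
have -> : (S + ew_error t.+1 ^+ 2) / 32 - 2 * tau * t.+1%:R + rho * (L + ln (mix t.+1))
    = (S / 32 - 2 * tau * t%:R + rho * L) +
      ((ew_error t.+1 ^+ 2 / 32 - 2 * tau) + rho * ln (mix t.+1)).
  by rewrite -natr1; ring.
rewrite expRD ler_pM ?expR_ge0//.
rewrite expRD /ew_factor ler_wpM2l ?expR_ge0//.
have := jensen_expR_power _ _ (fun i => - eta * excess_loss t.+1 i) _ rho1
  (ew_weight_ge0 t.+1) (sum_ew_weight t.+1) (mix_gt0 t.+1).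
move=> /le_trans; apply; rewrite le_eqVlt; apply/orP; left; apply/eqP.
by apply: eq_bigr => i _; congr (_ * expR _); rewrite etaE; field; lra.
Qed.

End ExponentialWeights.

(** * Measurability of the exponential-weights quantities *)

Section MeasurableExponentialWeights.
Context {d : measure_display} {S : measurableType d} {R : realType}.

Lemma measurable_sum_in (I : eqType) (s : seq I) (h : I -> S -> R) :
  (forall i, i \in s -> measurable_fun setT (h i)) ->
  measurable_fun setT (fun x => \sum_(i <- s) h i x).
Proof.
elim: s => [|i s IH] mh.
  by under eq_fun do rewrite big_nil; exact: measurable_cst.
under eq_fun do rewrite big_cons; apply: measurable_funD.
  by apply: mh; rewrite mem_head.
by apply: IH => j js; apply: mh; rewrite in_cons js orbT.
Qed.

Context {d1 d2 N : nat} (net : 'I_N -> 'M[R]_(d1, d2)) (eta : R).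
Variables (Theta : 'M[R]_(d1, d2)) (i0 : 'I_N) (tau : R).
Variables (X : nat -> S -> 'M[R]_(d1, d2)) (y : nat -> S -> R).

Lemma measurable_mxinner s A : (forall i j, measurable_fun setT (fun w => X s w i j)) ->
  measurable_fun setT (fun w => mxinner (X s w) A).
Proof.
move=> mX; under eq_fun do rewrite mxinnerE.
apply: measurable_sum_in => i _; apply: measurable_sum_in => j _.
by apply: measurable_funM => //; exact: measurable_cst.
Qed.

Section OneRound.
Variable t : nat.
Hypothesis mX : forall s i j, (1 <= s <= t)%N ->
  measurable_fun setT (fun w => X s w i j).

Lemma measurable_mxinner_le s A : (1 <= s <= t)%N ->
  measurable_fun setT (fun w => mxinner (X s w) A).
Proof. by move=> st; apply: measurable_mxinner => i j; exact: mX. Qed.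

Section Past.
Hypothesis my : forall s, (1 <= s < t)%N -> measurable_fun setT (y s).

Lemma measurable_cum_loss i u : (u < t)%N ->
  measurable_fun setT (fun w => cum_loss net (X ^~ w) (y ^~ w) i u).
Proof.
move=> ut; apply: measurable_sum_in => s; rewrite mem_index_iota => /andP[s1 su].
have st : (s < t)%N by exact: leq_trans su _.
apply: measurable_funX; apply: measurable_funB.
  by apply: my; rewrite s1.
by apply: measurable_mxinner_le; rewrite s1 ltnW.
Qed.

Lemma measurable_ew_weight i : (0 < t)%N ->
  measurable_fun setT (fun w => ew_weight net eta (X ^~ w) (y ^~ w) t i).
Proof.
move=> t0.
have mexp j : measurable_fun setT
    (fun w => expR (- eta * cum_loss net (X ^~ w) (y ^~ w) j t.-1)).
  apply: (measurableT_comp (@measurable_expR _)); apply: measurable_funM.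
    exact: measurable_cst.
  by apply: measurable_cum_loss; rewrite prednK.
(* Since the denominator is positive, its inverse is the real power of exponent -1, a measurable
   function. *)
rewrite /ew_weight; under eq_fun do rewrite -powR_inv1 ?ltW ?weight_sum_gt0//.
apply: measurable_funM => //.
apply: (measurableT_comp (measurable_powR (-1))).
by apply: measurable_sum_in.
Qed.

Lemma measurable_ew_error : (0 < t)%N ->
  measurable_fun setT (fun w => ew_error net eta Theta (X ^~ w) (y ^~ w) t).
Proof.
move=> t0; rewrite /ew_error; under eq_fun do rewrite ew_predictionE.
apply: measurable_funB; last by apply: measurable_mxinner_le; rewrite t0 leqnn.
apply: measurable_sum_in => i _; apply: measurable_funM.
  exact: measurable_ew_weight.
by apply: measurable_mxinner_le; rewrite t0 leqnn.
Qed.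

Lemma measurable_ew_exponent i : (0 < t)%N ->
  measurable_fun setT (fun w => ew_exponent net Theta i0 (X ^~ w) t i).
Proof.
move=> t0; have mx A : measurable_fun setT (fun w => mxinner (X t w) A).
  by apply: measurable_mxinner_le; rewrite t0 leqnn.
have := mx Theta; have := mx (net i); have := mx (net i0) => mi0 mi mT.
by rewrite /ew_exponent; solve_meas.
Qed.

Lemma measurable_ew_coeff i : (0 < t)%N ->
  measurable_fun setT (fun w => ew_coeff net eta Theta i0 tau (X ^~ w) (y ^~ w) t i).
Proof.
move=> t0; have mx A : measurable_fun setT (fun w => mxinner (X t w) A).
  by apply: measurable_mxinner_le; rewrite t0 leqnn.
have := mx Theta; have := mx (net i); have := mx (net i0) => mi0 mi mT.
have := measurable_ew_error t0; have := measurable_ew_weight i t0 => mw me.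
rewrite /ew_coeff.
by solve_meas.
Qed.

End Past.

Lemma measurable_ew_factor : (0 < t)%N ->
  (forall s, (1 <= s <= t)%N -> measurable_fun setT (y s)) ->
  measurable_fun setT (fun w => ew_factor net eta Theta i0 tau (X ^~ w) (y ^~ w) t).
Proof.
move=> t0 my; have my' s : (1 <= s < t)%N -> measurable_fun setT (y s).
  by move=> /andP[s1 st]; apply: my; rewrite s1 ltnW.
have mx A : measurable_fun setT (fun w => mxinner (X t w) A).
  by apply: measurable_mxinner_le; rewrite t0 leqnn.
have myt : measurable_fun setT (y t) by apply: my; rewrite t0 leqnn.
under eq_fun do rewrite ew_factorE.
apply: measurable_sum_in => i _; apply: measurable_funM.
  exact: measurable_ew_coeff.
apply: (measurableT_comp (@measurable_expR _)); apply: measurable_funM.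
  exact: measurable_ew_exponent.
exact: measurable_funB.
Qed.

End OneRound.

Lemma measurable_ew_potential t :
  (forall s i j, (1 <= s <= t)%N -> measurable_fun setT (fun w => X s w i j)) ->
  (forall s, (1 <= s <= t)%N -> measurable_fun setT (y s)) ->
  measurable_fun setT (fun w => ew_potential net eta Theta i0 tau (X ^~ w) (y ^~ w) t).
Proof.
move=> mX my; apply: measurable_prod => s; rewrite mem_index_iota => /andP[s1 st].
apply: measurable_ew_factor => // [u i j /andP[u1 us]|u /andP[u1 us]].
  by apply: mX; rewrite u1 (leq_trans us).
by apply: my; rewrite u1 (leq_trans us).
Qed.

End MeasurableExponentialWeights.

(** * From the conditional to the integrated sub-Gaussian bound *)

Section ConditionallySubgaussian.
Context {d : measure_display} {Omega : measurableType d} {R : realType}.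
Variables (P : probability Omega R) (G : set (set Omega)) (f : Omega -> R).
Hypothesis Gmeas : G `<=` measurable.

Lemma cond_subgaussian_integral (lambda : R) A :
  cond_centered_subgaussian P G f -> G A ->
  (\int[P]_(w in A) (expR (lambda * f w))%:E
   <= (expR (lambda ^+ 2 / 2))%:E * P A)%E.
Proof.
move=> [_ /(_ lambda)[g [[_ gint _ gE] gle]]] GA.
have mA := Gmeas _ GA.
have mg : measurable_fun A (EFin \o g).
  exact: measurable_funS (measurable_int _ gint).
rewrite -gE// integralE -integral_cst//.
(* The version [g] is bounded above almost surely but may be negative somewhere, so its positive
   part is compared with the constant. *)
apply: (@le_trans _ _ (\int[P]_(x in A) ((EFin \o g)^\+ x))%E).
  by rewrite geeDl// oppe_le0 integral_ge0.
apply: ae_ge0_le_integral => //.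
- exact: measurable_funepos.
- by move=> x _; rewrite lee_fin expR_ge0.
apply: filterS gle => w gw _.
by rewrite funeposE ge_max /= !lee_fin gw expR_ge0.
Qed.

End ConditionallySubgaussian.

(** * The supermartingale and the high-probability event *)

Section ConfidenceEvent.
Context {d : measure_display} {Omega : measurableType d} {R : realType}.
Variable P : probability Omega R.
Context {d1 d2 N : nat}.
Variables (net : 'I_N -> 'M[R]_(d1, d2)) (eta : R) (T : nat).
Variables (Theta : 'M[R]_(d1, d2)) (i0 : 'I_N).
Variables (X : nat -> Omega -> 'M[R]_(d1, d2)) (noise : nat -> Omega -> R).
Hypothesis T0 : (0 < T)%N.
Hypothesis mX : forall t i j, (1 <= t <= T)%N ->
  measurable_fun setT (fun w => X t w i j).
Hypothesis mnoise : forall t, measurable_fun setT (noise t).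
Hypothesis subg : forall t, (1 <= t <= T)%N ->
  cond_centered_subgaussian P (history X noise t) (noise t).
Hypothesis X1 : forall t w, (1 <= t <= T)%N -> frobenius (X t w) <= 1.
Hypothesis net1 : forall i, frobenius (net i) <= 1.
Hypothesis Theta1 : frobenius Theta <= 1.
Hypothesis net_i0 : frobenius (Theta - net i0) <= T%:R^-1.

Let y t w : R := mxinner (X t w) Theta + noise t w.
(** Bounds both the squared deviation of the net point [i0] and the squared mesh of the chord
    argument. *)
Let tau : R := T%:R^-1 ^+ 2.
Let potential t w := ew_potential net eta Theta i0 tau (X ^~ w) (y ^~ w) t.

(* [history X noise t] is convertible to the measurable sets of [past t] below. *)
Definition history_generators (t : nat) : set (set Omega) :=
  [set A | (exists s i j, (1 <= s <= t)%N /\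
              g_sigma_algebra_preimage (fun w => X s w i j) A) \/
           (exists s, (1 <= s < t)%N /\ g_sigma_algebra_preimage (noise s) A)].

Local Notation past t := (g_sigma_algebraType (history_generators t)).

Lemma history_measurable t : (t <= T)%N -> history X noise t `<=` measurable.
Proof.
move=> tT; apply: smallest_sub; first exact: sigma_algebra_measurable.
move=> A [[s [i [j [/andP[s1 st] [B mB <-]]]]]|[s [_ [B mB <-]]]].
  by apply: mX => //; rewrite s1 (leq_trans st).
exact: mnoise.
Qed.

Lemma arm_past_measurable t s i j : (1 <= s <= t)%N ->
  measurable_fun setT (fun w : past t => X s w i j).
Proof.
move=> st _ B mB; apply: sub_sigma_algebra; left.
by exists s, i, j; split=> //; exists B.
Qed.

Lemma noise_past_measurable t s : (1 <= s < t)%N ->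
  measurable_fun setT (noise s : past t -> R).
Proof.
move=> st _ B mB; apply: sub_sigma_algebra; right.
by exists s; split=> //; exists B.
Qed.

Lemma reward_past_measurable t s : (1 <= s < t)%N ->
  measurable_fun setT (y s : past t -> R).
Proof.
move=> /andP[s1 st]; apply: measurable_funD.
  apply: measurable_mxinner => i j.
  by apply: arm_past_measurable; rewrite s1 ltnW.
by apply: noise_past_measurable; rewrite s1.
Qed.

Lemma id_past_measurable t : (t <= T)%N ->
  measurable_fun setT (id : Omega -> past t).
Proof.
by move=> tT _ B mB; rewrite setTI; exact: (history_measurable t tT).
Qed.

Lemma reward_measurable s : (1 <= s <= T)%N -> measurable_fun setT (y s).
Proof.
move=> sT; apply: measurable_funD => //.
by apply: measurable_mxinner => i j; exact: mX.
Qed.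

Lemma potential_measurable t : (t <= T)%N -> measurable_fun setT (potential t).
Proof.
move=> tT; apply: measurable_ew_potential => [s i j /andP[s1 st]|s /andP[s1 st]].
  by apply: mX; rewrite s1 (leq_trans st).
by apply: reward_measurable; rewrite s1 (leq_trans st).
Qed.

Lemma arm_dev_le2 t w i : (1 <= t <= T)%N ->
  `|mxinner (X t w) (net i) - mxinner (X t w) Theta| <= 2.
Proof.
move=> tT; apply: le_trans (ler_normB _ _) _.
have := mxinner_le1 _ _ (X1 _ w tT) (net1 i).
have := mxinner_le1 _ _ (X1 _ w tT) Theta1; lra.
Qed.

Lemma arm_dev_i0 t w : (1 <= t <= T)%N ->
  (mxinner (X t w) (net i0) - mxinner (X t w) Theta) ^+ 2 <= tau.
Proof.
move=> tT; rewrite -mxinnerBr -real_normK ?num_real//.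
rewrite lerXn2r ?nnegrE ?invr_ge0//.
apply: le_trans (mxinner_cauchy _ _) _.
have -> : frobenius (net i0 - Theta) = frobenius (Theta - net i0).
  rewrite /frobenius !mxinnerE; congr Num.sqrt.
  by apply: eq_bigr => i _; apply: eq_bigr => j _; rewrite !mxE; ring.
by rewrite -[leRHS]mul1r ler_pM ?frobenius_ge0// X1.
Qed.

(** The supermartingale step, in expectation. [H] merges the past potential with the coefficients of
    the new factor, all measurable for the past, so the noise can be integrated out term by term;
    what remains of the factor is at most 1. *)
Lemma expect_potentialS t : (t.+1 <= T)%N ->
  (ge0_expect P (potential t.+1) <= ge0_expect P (potential t))%E.
Proof.
move=> tT; have tT' : (1 <= t.+1 <= T)%N by [].
pose H i w := potential t w *
  ew_coeff net eta Theta i0 tau (X ^~ w) (y ^~ w) t.+1 i.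
pose Lam i w := ew_exponent net Theta i0 (X ^~ w) t.+1 i.
have H0 i w : 0 <= H i w by rewrite mulr_ge0 ?ew_potential_ge0 ?ew_coeff_ge0.
have mH i : measurable_fun setT (H i : past t.+1 -> R).
  apply: measurable_funM.
    apply: measurable_ew_potential => [s i' j /andP[s1 st]|s /andP[s1 st]].
      by apply: arm_past_measurable; rewrite s1 (leq_trans st).
    by apply: reward_past_measurable; rewrite s1.
  apply: measurable_ew_coeff => // [s i' j st|s st].
    exact: arm_past_measurable.
  exact: reward_past_measurable.
have mLam i : measurable_fun setT (Lam i : past t.+1 -> R).
  by apply: (@measurable_ew_exponent _ (past t.+1)) => // s i' j st; exact: arm_past_measurable.
have mid := id_past_measurable t.+1 tT.
have mHO i : measurable_fun setT (H i : Omega -> R) := measurableT_comp (mH i) mid.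
have mLO i : measurable_fun setT (Lam i : Omega -> R) := measurableT_comp (mLam i) mid.
have Lam1 i w : `|Lam i w| <= 1.
  have := arm_dev_le2 _ w i tT'; have := arm_dev_le2 _ w i0 tT'.
  rewrite /Lam /ew_exponent !ler_norml; lra.
have -> : ge0_expect P (potential t.+1)
    = (\sum_i \E0[P]_w (H i w * expR (Lam i w * noise t.+1 w)))%E.
  rewrite -ge0_expect_sum; last 2 first.
  - by move=> i; have := mnoise t.+1; have := mHO i; have := mLO i => ? ? ?; solve_meas.
  - by move=> i w; rewrite mulr_ge0 ?expR_ge0.
  congr ge0_expect; apply/funext => w.
  rewrite /potential ew_potentialS ew_factorE mulr_sumr.
  apply: eq_bigr => i _; rewrite mulrA; congr (_ * expR (_ * _)).
  by rewrite /y addrAC subrr add0r.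
apply: (@le_trans _ _ (\sum_i \E0[P]_w (H i w * expR (Lam i w ^+ 2 + tau)))%E).
  apply: lee_sum => i _.
  have subg_id (lambda : R) (A : set (past t.+1)) : measurable A ->
      (\int[P]_(w in (id : Omega -> past t.+1) @^-1` A) (expR (lambda * noise t.+1 w))%:E
       <= (expR (lambda ^+ 2 / 2))%:E * P ((id : Omega -> past t.+1) @^-1` A))%E.
    move=> mA; apply: (cond_subgaussian_integral P _ _ (history_measurable t.+1 tT)) => //.
    exact: subg.
  (* With [T] as the inverse mesh, the chord error of a round is exactly [tau]. *)
  have := subgaussian_le (S := past t.+1) P id mid (noise t.+1) (mnoise _) subg_id
    (Lam i) (mLam i) (H i) T T0 (mH i) (H0 i) (Lam1 i).
  exact.
rewrite -ge0_expect_sum; last 2 first.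
- by move=> i; have := mHO i; have := mLO i => ? ?; solve_meas.
- by move=> i w; rewrite mulr_ge0 ?expR_ge0.
apply: le_ge0_expect.
- by apply: measurable_sum_in => i _; have := mHO i; have := mLO i => ? ?; solve_meas.
- by apply: potential_measurable; rewrite ltnW.
- by move=> w; apply: sumr_ge0 => i _; rewrite mulr_ge0 ?expR_ge0.
move=> w; under eq_bigr do rewrite -mulrA.
rewrite -mulr_sumr -[leRHS]mulr1 ler_wpM2l ?ew_potential_ge0//.
by apply: sum_ew_coeff_le1 => [i|]; [exact: arm_dev_le2|exact: arm_dev_i0].
Qed.

Lemma expect_potential_le1 t : (t <= T)%N -> (ge0_expect P (potential t) <= 1)%E.
Proof.
elim: t => [_|t IH tT]; last exact: le_trans (expect_potentialS _ tT) (IH (ltnW tT)).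
rewrite /ge0_expect /potential /ew_potential.
under eq_integral do rewrite big_geq//.
rewrite integral_cst// mul1e; exact: probability_le1.
Qed.

(** Markov's inequality, through the indicator of the complementary event. *)
Lemma potential_tail (delta : R) : 0 < delta ->
  ((1 - delta)%:E <= P [set w | (potential T w <= delta^-1)%R])%E.
Proof.
move=> delta0; have mpot := potential_measurable T (leqnn T).
pose A := [set w | potential T w <= delta^-1].
have mA : measurable A.
  by rewrite -[A]setTI; apply: measurable_fun_le => //; exact: measurable_cst.
have mAC : measurable (~` A) by exact: measurableC.
have PAC : (P (~` A) <= delta%:E)%E.
  have : (\E0[P]_w (delta^-1 * \1_(~` A) w) <= 1)%E.
    apply: le_trans (expect_potential_le1 _ (leqnn T)).
    apply: le_ge0_expect => //.
    - apply: measurable_funM; first exact: measurable_cst.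
      exact: measurable_indic.
    - by move=> w; rewrite mulr_ge0// invr_ge0 ltW.
    move=> w; rewrite indicE; have [/set_mem|_] := boolP (w \in _).
      by rewrite mulr1 /A /= => /negP; rewrite -ltNge => /ltW.
    by rewrite mulr0 ew_potential_ge0.
  rewrite ge0_expectZ//; last by rewrite invr_ge0 ltW.
  rewrite /ge0_expect integral_indic// setIT => h.
  have := lee_wpmul2l (_ : (0 <= delta%:E)%E) h.
  rewrite muleA -EFinM divff ?gt_eqF// mul1e mule1; apply.
  by rewrite lee_fin ltW.
have := probability_setC P mAC; rewrite setCK => ->.
by rewrite EFinB leeB.
Qed.

(** On the event of [potential_tail], take logarithms in [ew_potential_ge] at the horizon [T], where
    [2 * tau * T%:R] is [2 / T], at most 2. *)
Lemma error_tail (delta rho : R) : 0 < delta -> 1 <= rho -> eta = (16 * rho)^-1 ->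
  exists E : set Omega, [/\ measurable E, ((1 - delta)%:E <= P E)%E &
    forall w, E w ->
      \sum_(1 <= s < T.+1) ew_error net eta Theta (X ^~ w) (y ^~ w) s ^+ 2
      <= 32 * (2 + rho * ln N%:R + ln (1 / delta))].
Proof.
move=> delta0 rho1 etaE; exists [set w | potential T w <= delta^-1]; split.
- rewrite -[X in measurable X]setTI; apply: measurable_fun_le => //.
  exact: potential_measurable.
- exact: potential_tail.
move=> w /= potle.
have := le_trans (ew_potential_ge net eta Theta i0 tau (X ^~ w) (y ^~ w) rho T rho1 etaE) potle.
rewrite -[X in _ <= X]lnK ?posrE ?invr_gt0// ler_expR div1r.
have -> : 2 * tau * T%:R = 2 * T%:R^-1.
  by rewrite /tau expr2 -!mulrA mulVf ?mulr1// pnatr_eq0 -lt0n.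
have : T%:R^-1 <= 1 :> R by rewrite invf_le1 ?ler1n ?ltr0n.
lra.
Qed.

End ConfidenceEvent.

(** * Numerical estimates *)

Section Constants.
Context {R : realType}.

(** [ln 4] is twice [- ln (1 / 2)], and [ln (1 - 1 / 2) <= - 1 / 2]. *)
Lemma ln_ge1 (x : R) : 4 <= x -> 1 <= ln x.
Proof.
move=> x4; apply: (@le_trans _ _ (ln 4)); last by rewrite ler_ln ?posrE; lra.
have -> : 4 = 2^-1^-1 * 2^-1^-1 :> R by rewrite !invrK; ring.
rewrite lnM ?posrE ?invr_gt0//.
have half_gt0 : 0 < 2^-1 :> R by lra.
rewrite lnV ?posrE//.
have := @le_ln1Dx R (- 2^-1); have -> : 1 + - 2^-1 = 2^-1 :> R by field.
by move=> h; have := h ltac:(lra); lra.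
Qed.

Lemma le_ln_sub1 (x : R) : 0 < x -> ln x <= x - 1.
Proof.
move=> x0; have := @le_ln1Dx R (x - 1).
have -> : 1 + (x - 1) = x by ring.
by apply; lra.
Qed.

Lemma sqrt_le_id (x : R) : 1 <= x -> Num.sqrt x <= x.
Proof.
move=> x1; rewrite -[leRHS]ger0_norm ?(le_trans ler01)// -sqrtr_sqr.
by rewrite ler_wsqrtr// expr2 ler_peMl// (le_trans ler01).
Qed.

Lemma powR_three_halves_sqr (x : R) : 0 <= x -> (x `^ (3 / 2)) ^+ 2 = x ^+ 3.
Proof.
move=> x0; rewrite -powR_mulrn ?powR_ge0// -powRrM -powR_mulrn//.
by congr (_ `^ _); field.
Qed.

Lemma ln_net_card (N m k : nat) : (0 < N)%N -> (0 < m)%N -> (N <= m ^ k)%N ->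
  ln N%:R <= k%:R * ln m%:R :> R.
Proof.
move=> N0 m0 Nle; have -> : k%:R * ln m%:R = ln ((m ^ k)%N%:R) :> R.
  by rewrite natrX lnXn ?ltr0n// mulr_natl.
by rewrite ler_ln ?posrE ?ltr0n ?expn_gt0 ?m0// ler_nat.
Qed.

Lemma conf_radius_ge (delta B : R) t : 0 < delta <= 1 / 4 -> 0 <= B ->
  1 + 2 * B <= conf_radius delta (fun=> B) t.
Proof.
move=> /andP[delta0 delta4] B0; rewrite /conf_radius lerDl mulr_ge0// ln_ge0//.
rewrite ler_pdivlMr// mul1r.
have s8 : 1 <= Num.sqrt 8 :> R by rewrite -[leLHS]sqrtr1 ler_wsqrtr//; lra.
have := sqrtr_ge0 (1 + B); lra.
Qed.

Lemma conf_radius_le (delta B : R) t : 0 < delta -> 0 <= B ->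
  conf_radius delta (fun=> B) t <= 97 + 34 * B + 32 * ln (1 / delta).
Proof.
move=> delta0 B0; rewrite /conf_radius.
have s8 : Num.sqrt 8 <= 3 :> R.
  by rewrite -[leRHS]ger0_norm// -sqrtr_sqr ler_wsqrtr//; lra.
have s8' : 0 < Num.sqrt 8 :> R by rewrite sqrtr_gt0.
have sB : Num.sqrt (1 + B) <= 1 + B by apply: sqrt_le_id; lra.
have sB' := sqrtr_ge0 (1 + B).
set a := Num.sqrt 8 + _.
have a0 : 0 < a by rewrite /a; lra.
have -> : ln (a / delta) = ln a + ln (1 / delta).
  by rewrite div1r lnM// ?posrE// invr_gt0.
have := le_ln_sub1 a a0; rewrite /a; lra.
Qed.

End Constants.

Definition loss_budget {R : realType} (d1 d2 r T : nat) (delta : R) : R :=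
  80 * (d1 + d2)%:R * r%:R * ln (9 * T%:R) * ln (2 * T%:R / delta).

Lemma ln_horizon_bounds {R : realType} (T : nat) (delta : R) :
  (0 < T)%N -> 0 < delta -> delta <= 1 / 4 ->
  [/\ 1 <= ln (1 / delta), 1 <= ln (T%:R / delta), 1 <= ln (9 * T%:R : R)
    & ln (2 * T%:R / delta) = ln (2 * T%:R) + ln (1 / delta)].
Proof.
move=> T_gt0 delta_gt0 delta_le; have T1 : 1 <= T%:R :> R by rewrite ler1n.
have idelta4 : 4 <= delta^-1 by rewrite -[delta^-1]mul1r ler_pdivlMr//; lra.
split.
- by rewrite div1r ln_ge1.
- by apply: ln_ge1; nra.
- by apply: ln_ge1; lra.
- by rewrite div1r [LHS]lnM ?posrE ?invr_gt0//; lra.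
Qed.

(** Source of the constant 80. With [K] and [l] as in the proof, [ln N] is at most [2 * K] because
    [d1 + d2 + 1 <= 2 * (d1 + d2)]; the bracket is then at most [5 * (K * l)], and
    [32 * 5 = 2 * 80]. *)
Lemma confidence_budget_ge {R : realType} (d1 d2 r T N : nat) (delta : R) :
  (0 < d1)%N -> (0 < d2)%N -> (0 < r)%N -> (0 < T)%N ->
  0 < delta -> delta <= 1 / 4 ->
  let B := loss_budget d1 d2 r T delta in
  (0 < N)%N ->
  (N <= (9 * T) ^ ((d1 + d2 + 1) * r))%N ->
  0 <= B /\
  32 * (2 + ln (T%:R / delta) * ln N%:R + ln (1 / delta)) <= 2 * B.
Proof.
move=> d1_gt0 d2_gt0 r_gt0 T_gt0 delta_gt0 delta_le B N0 Nle.
have T1 : 1 <= T%:R :> R by rewrite ler1n.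
have r1 : 1 <= r%:R :> R by rewrite ler1n.
have s1 : 1 <= (d1 + d2)%:R :> R by rewrite ler1n addn_gt0 d1_gt0.
have [lam1 rho1 l9 ltwo] := ln_horizon_bounds T delta T_gt0 delta_gt0 delta_le.
have lnN : ln N%:R <= 2 * ((d1 + d2)%:R * r%:R * ln (9 * T%:R)) :> R.
  apply: le_trans (ln_net_card _ _ _ N0 _ Nle) _; first by rewrite muln_gt0.
  rewrite !natrM [(_ + 1)%:R]natrD.
  have : 0 <= r%:R * ln (9 * T%:R : R) * ((d1 + d2)%:R - 1).
    by rewrite !mulr_ge0//; lra.
  lra.
have lnN0 : 0 <= ln N%:R :> R by rewrite ln_ge0// ler1n.
have l2 : 1 <= ln (2 * T%:R / delta).
  have : 0 <= ln (2 * T%:R : R) by apply: ln_ge0; lra.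
  by rewrite ltwo; lra.
have rhole : ln (T%:R / delta) <= ln (2 * T%:R / delta).
  rewrite ler_ln ?posrE ?divr_gt0//; try lra.
  rewrite ler_pM2r ?invr_gt0//; lra.
have lamle : ln (1 / delta) <= ln (2 * T%:R / delta).
  by rewrite ltwo lerDr ln_ge0//; lra.
set K := (d1 + d2)%:R * r%:R * ln (9 * T%:R) in lnN.
have K1 : 1 <= K.
  have sr : 1 <= (d1 + d2)%:R * r%:R :> R by rewrite -natrM ler1n muln_gt0 addn_gt0 d1_gt0.
  by rewrite /K; nra.
have BE : B = 80 * (K * ln (2 * T%:R / delta)) by rewrite /B /loss_budget /K; ring.
clearbody K.
set a := ln (T%:R / delta) in rhole rho1 *; set l := ln (2 * T%:R / delta) in BE l2 rhole lamle *.
rewrite BE.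
have Kl : l <= K * l by rewrite ler_peMl//; lra.
have aN : a * ln N%:R <= 2 * (K * l).
  rewrite mulrA mulrC; apply: ler_pM => //; lra.
split; nra.
Qed.

(** Every logarithm of the horizon is bounded through [ell]. The exponent 3/2 arises because [gamma]
    carries one factor [s] and [d1 * d2] at most two more. *)
Lemma regret_rate {R : realType} (d1 d2 r T : nat) (delta gamma : R) :
  (0 < d1)%N -> (0 < d2)%N -> (0 < r)%N -> (0 < T)%N ->
  0 < delta -> delta <= 1 / 4 ->
  let B := loss_budget d1 d2 r T delta in
  0 <= B ->
  gamma <= 98 + 34 * B + 32 * ln (1 / delta) ->
  Num.sqrt (T%:R * (8 * gamma * (d1 * d2)%:R * ln (1 + T%:R)))
  <= 800 * (ln (2 + d1%:R + d2%:R + r%:R + T%:R)) `^ 2 *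
     ((d1 + d2)%:R `^ (3 / 2) * Num.sqrt (r%:R * T%:R) * Num.sqrt (ln (1 / delta))).
Proof.
move=> d1_gt0 d2_gt0 r_gt0 T_gt0 delta_gt0 delta_le B B0 gammale.
have T1 : 1 <= T%:R :> R by rewrite ler1n.
have r1 : 1 <= r%:R :> R by rewrite ler1n.
have s1 : 1 <= (d1 + d2)%:R :> R by rewrite ler1n addn_gt0 d1_gt0.
have [lam1 rho1 l9 ltwo] := ln_horizon_bounds T delta T_gt0 delta_gt0 delta_le.
have d11 : 1 <= d1%:R :> R by rewrite ler1n.
have d21 : 1 <= d2%:R :> R by rewrite ler1n.
set ell := ln (2 + _ + _ + _ + _); set s : R := (d1 + d2)%:R.
have sE : s = d1%:R + d2%:R by rewrite /s natrD.
have ell1 : 1 <= ell by apply: ln_ge1; lra.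
have lnle (x : R) : 0 < x -> x <= 1 + T%:R -> ln x <= ell.
  by move=> x0 xT; rewrite ler_ln ?posrE; lra.
have ln1T : ln (1 + T%:R) <= ell by apply: lnle; lra.
have lnT : ln T%:R <= ell by apply: lnle; lra.
have ln9 : ln (9 * T%:R) <= 9 * ell.
  rewrite lnM ?posrE//; try lra.
  have := le_ln_sub1 (9 : R) ltac:(lra); lra.
have ln2 : ln (2 * T%:R / delta) <= 3 * (ell * ln (1 / delta)).
  rewrite ltwo lnM ?posrE//; try lra.
  have := le_ln_sub1 (2 : R) ltac:(lra).
  have : ell <= ell * ln (1 / delta) by rewrite ler_peMr//; lra.
  have : ln (1 / delta) <= ell * ln (1 / delta) by rewrite ler_peMl//; lra.
  lra.
have ln2_0 : 0 <= ln (2 * T%:R / delta).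
  have : 0 <= ln (2 * T%:R : R) by apply: ln_ge0; lra.
  by rewrite ltwo; lra.
set lam := ln (1 / delta) in gammale ln2 *.
have lam1' : 1 <= lam := lam1.
pose M := s * r%:R * (ell ^+ 2 * lam).
have sr1 : 1 <= s * r%:R by rewrite /s -natrM ler1n muln_gt0 addn_gt0 d1_gt0.
have ell2 : 1 <= ell ^+ 2 by rewrite expr_ge1//; lra.
have el1 : 1 <= ell ^+ 2 * lam by nra.
have lamM : lam <= M.
  have : lam <= ell ^+ 2 * lam by rewrite ler_peMl//; lra.
  rewrite /M; nra.
have BM : B <= 80 * (27 * M).
  have -> : B = s * r%:R * (80 * (ln (9 * T%:R) * ln (2 * T%:R / delta))).
    by rewrite /B /loss_budget; ring.
  have -> : 80 * (27 * M) = s * r%:R * (80 * ((9 * ell) * (3 * (ell * lam)))).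
    by rewrite /M; ring.
  rewrite ler_wpM2l//; first lra.
  rewrite ler_wpM2l// ler_pM//; lra.
have M1 : 1 <= M by lra.
(* Indeed [98 + 34 * 80 * 27 + 32 = 73570]; the rounded value 80000 makes [8 * 80000] the square of
   800. *)
have gammaM : gamma <= 200 * (400 * M) by lra.
have d12 : (d1 * d2)%:R <= s ^+ 2.
  by rewrite natrM sE; nra.
have rhs0 : 0 <= 800 * ell `^ 2 * (s `^ (3 / 2) * Num.sqrt (r%:R * T%:R) * Num.sqrt lam).
  apply: mulr_ge0; first by apply: mulr_ge0 (powR_ge0 _ _); lra.
  by rewrite !mulr_ge0 ?powR_ge0 ?sqrtr_ge0.
rewrite -[leRHS]ger0_norm// -sqrtr_sqr ler_wsqrtr// !exprMn.
rewrite powR_three_halves_sqr; last lra.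
rewrite !sqr_sqrtr ?mulr_ge0//; try lra.
have -> : (ell `^ 2) ^+ 2 = ell ^+ 4.
  by rewrite powR_mulrn -?exprM//; lra.
apply: (@le_trans _ _ (T%:R * (8 * (200 * (400 * M)) * s ^+ 2 * ell))).
  rewrite ler_wpM2l//.
  have h1 : 8 * gamma * (d1 * d2)%:R <= 8 * (200 * (400 * M)) * s ^+ 2.
    apply: le_trans (_ : 8 * (200 * (400 * M)) * (d1 * d2)%:R <= _).
      by rewrite ler_wpM2r//; lra.
    by rewrite ler_wpM2l//; lra.
  have h2 : 0 <= ln (1 + T%:R) :> R by apply: ln_ge0; lra.
  apply: le_trans (ler_wpM2r h2 h1) _.
  apply: ler_wpM2l => //; apply: mulr_ge0 (sqr_ge0 _); lra.
have -> : T%:R * (8 * (200 * (400 * M)) * s ^+ 2 * ell)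
    = (800 ^+ 2 * ell ^+ 3) * (s ^+ 3 * (r%:R * T%:R) * lam).
  by rewrite /M; ring.
rewrite ler_wpM2r//.
  by rewrite !mulr_ge0 ?exprn_ge0//; lra.
by rewrite ler_wpM2l ?sqr_ge0// ler_weXn2l.
Qed.

(** * The regret bound with high probability *)

Theorem theorem1 (R : realType) :
  exists c C : R, 0 < c /\ 0 < C /\
  exists C' p : R, 0 < C' /\ 0 < p /\
  forall (d1 d2 r T : nat) (arms : set 'M[R]_(d1, d2))
    (Theta Xstar : 'M[R]_(d1, d2))
    (N : nat) (net : 'I_N -> 'M[R]_(d1, d2)) (delta : R)
    (d : measure_display) (Omega : measurableType d) (P : probability Omega R)
    (noise : nat -> {RV P >-> R})
    (X Thetat : nat -> Omega -> 'M[R]_(d1, d2)),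
  let y (t : nat) (w : Omega) : R := mxinner (X t w) Theta + noise t w in
  let eta : R := c / ln (T%:R / delta) in
  let B (_ : nat) : R :=
    C * (d1 + d2)%:R * r%:R * ln (9 * T%:R) * ln (2 * T%:R / delta) in
  (0 < T)%N ->
  (forall A, arms A -> frobenius A <= 1) ->
  \rank Theta = r ->
  frobenius Theta <= 1 ->
  is_argmax arms (fun A => mxinner A Theta) Xstar ->
  is_net net (low_rank_ball r) (T%:R^-1) ->
  (N <= (9 * T) ^ ((d1 + d2 + 1) * r))%N ->
  0 < delta -> delta <= 1 / 4 ->
  (forall t i j, (1 <= t <= T)%N ->
    measurable_fun setT (fun w => X t w i j)) ->
  (forall t, (1 <= t <= T)%N ->
    cond_centered_subgaussian P (history X (fun s => noise s : Omega -> R) t)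
      (noise t)) ->
  (forall w, lowloc_run net delta eta B (fun t => X t w) (fun t => y t w)
    arms T (fun t => Thetat t w)) ->
  ((1 - delta)%:E <=
    P [set w | (regret Theta Xstar (fun t => X t w) T <=
        C' * (ln (2 + d1%:R + d2%:R + r%:R + T%:R)) `^ p *
        ((d1 + d2)%:R `^ (3 / 2) * Num.sqrt (r%:R * T%:R) *
         Num.sqrt (ln (1 / delta))))%R])%E.
Proof.
(* [c = 1 / 16] makes [eta] the inverse of [16 * rho] with [rho = ln (T / delta)]; [C = 80] is the
   constant of [loss_budget]. *)
exists (1 / 16), 80; split; first lra; split; first lra.
exists 800, 2; split; first lra; split; first lra.
move=> d1 d2 r T arms Theta Xstar N net delta d Omega P noise X Thetat y eta B.
move=> T0 arms1 rankTheta Theta1 Xstar_opt [netS net_cover] Nle delta0 delta4 mX subg run.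
(* At rank 0 the parameter and the regret vanish; a positive rank forces both dimensions to be
   positive, as the numerical estimates require. *)
have [r0|r_gt0] := posnP r.
  have Theta0 : Theta = 0 by apply/eqP; rewrite -mxrank_eq0 rankTheta r0.
  rewrite (_ : [set w | _] = setT); first by rewrite probability_setT lee_fin; lra.
  apply/seteqP; split=> // w _ /=.
  have -> : regret Theta Xstar (X ^~ w) T = 0.
    rewrite /regret big1// => t _.
    by rewrite Theta0 /mxinner mulmx0 linear0.
  apply: mulr_ge0; first by apply: mulr_ge0 (powR_ge0 _ _); lra.
  by rewrite !mulr_ge0 ?powR_ge0 ?sqrtr_ge0.
have d1_gt0 : (0 < d1)%N by rewrite (leq_trans r_gt0)// -rankTheta rank_leq_row.
have d2_gt0 : (0 < d2)%N by rewrite (leq_trans r_gt0)// -rankTheta rank_leq_col.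
have [i0 i0_close] := net_cover Theta (conj Theta1 (eq_leq rankTheta)).
have N0 : (0 < N)%N by rewrite (leq_trans _ (ltn_ord i0)).
have [lam1 rho1 l9 ltwo] := ln_horizon_bounds T delta T0 delta0 delta4.
have [B0 budget] := confidence_budget_ge d1 d2 r T N delta d1_gt0 d2_gt0 r_gt0 T0
  delta0 delta4 N0 Nle.
have etaE : eta = (16 * ln (T%:R / delta))^-1 by rewrite invfM -div1r.
have X1 t w : (1 <= t <= T)%N -> frobenius (X t w) <= 1.
  by move=> tT; apply: arms1; have [] := run w t tT.
have [E [mE PE errE]] := error_tail P net eta T Theta i0 X (fun s => noise s : Omega -> R)
  T0 mX (fun t => measurable_funP (noise t)) subg X1 (fun i => (netS i).1) Theta1 i0_close
  delta _ delta0 rho1 etaE.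
pose bound : R := 800 * (ln (2 + d1%:R + d2%:R + r%:R + T%:R)) `^ 2 *
  ((d1 + d2)%:R `^ (3 / 2) * Num.sqrt (r%:R * T%:R) * Num.sqrt (ln (1 / delta))).
have mregret : measurable [set w | regret Theta Xstar (X ^~ w) T <= bound].
  rewrite -[X in measurable X]setTI; apply: measurable_fun_le => //.
  apply: measurable_sum_in => t; rewrite mem_index_iota ltnS => tT.
  under eq_fun do rewrite mxinnerBl.
  apply: measurable_funB; first exact: measurable_cst.
  by apply: measurable_mxinner => i j; exact: mX.
apply: le_trans PE _; apply: le_measure; rewrite ?inE//.
move=> w /errE err_le /=.
(* As [B] is constant, the radius is the same at all times. *)
pose gamma := 1 + conf_radius delta B 0.
have delta01 : 0 < delta <= 1 / 4 by rewrite delta0.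
have b0 : 0 <= B 0%N := B0.
have radius_ge : 1 + 2 * B 0%N <= conf_radius delta B 0 :=
  conf_radius_ge delta (B 0%N) 0 delta01 B0.
have radius_le : conf_radius delta B 0 <= 97 + 34 * B 0%N + 32 * ln (1 / delta) :=
  conf_radius_le delta (B 0%N) 0 delta0 B0.
have {}budget : 32 * (2 + ln (T%:R / delta) * ln N%:R + ln (1 / delta)) <= 2 * B 0%N :=
  budget.
apply: le_trans (lowloc_regret_le net delta eta B (X ^~ w) (y ^~ w) arms T Theta Xstar
  (Thetat ^~ w) gamma _ _ arms1 Theta1 Xstar_opt (run w) _) _.
- by rewrite /gamma; clear -radius_ge b0; move: (B 0%N) b0 radius_ge => b; lra.
- by move=> t; rewrite /gamma.
(* The initial set only bounds the norm. For the later ones, the partial sum of squared errors is at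
   most the sum over all [T] rounds, so the single event covers every round. *)
- move=> [|t] tT /=; first by rewrite exprn_ile1 ?frobenius_ge0.
  apply: lerD; first by rewrite exprn_ile1 ?frobenius_ge0.
  apply: le_trans (_ : 1 + 2 * B 0%N <= _); last exact: radius_ge.
  apply: (@le_trans _ _ (\sum_(1 <= s < T.+1)
      ew_error net eta Theta (X ^~ w) (y ^~ w) s ^+ 2)).
    under eq_bigr do rewrite (mxinnerC Theta).
    rewrite [leRHS](@big_cat_nat _ _ _ t.+2)//=; last by rewrite ltnW// ltnS.
    by rewrite lerDl; apply: sumr_ge0 => s _; exact: sqr_ge0.
  apply: le_trans err_le _; apply: le_trans budget _.
  by clear; move: (B 0%N) => b; lra.
apply: regret_rate => //.
have -> : loss_budget d1 d2 r T delta = B 0%N by [].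
by rewrite /gamma; move: radius_le; move: (B 0%N) => b; lra.
Qed.
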